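(* Let $d,l \in \mathbb{N}$ and $\mathbf{c} = (c_1,\ldots,c_l) \in \mathbb{N}^l$, and let $G$ be an $\mathcal{N}_{\mathbf{c}}$-free group of rank $d$, i.e. a free polynilpotent group of class row $\mathbf{c}$ that is freely generated (relative to $\mathcal{N}_{\mathbf{c}}$) by $d$ elements. Then $G$ has the Magnus property if and only if $G$ is nilpotent of class at most $2$; equivalently, $G$ has the Magnus property if and only if $d=1$ or $\mathbf{c} \in \{(1),(2)\}$.
   Context: $\mathbb{N} = \{1,2,3,\ldots\}$. A group $G$ has the Magnus property if, whenever $g,h \in G$ generate the same normal subgroup $\langle g\rangle^G = \langle h\rangle^G$ (normal closures), $g$ is conjugate in $G$ to $h$ or to $h^{-1}$. For a group $G$, $\gamma_1(G)=G$ and $\gamma_{i+1}(G)=[\gamma_i(G),G]$ denote the terms of the lower central series. The iterated lower central series is defined by $\gamma_{(c_1+1)}(G)=\gamma_{c_1+1}(G)$ and, for $l>1$, $\gamma_{(c_1+1,\ldots,c_l+1)}(G) = \gamma_{c_l+1}\big(\gamma_{(c_1+1,\ldots,c_{l-1}+1)}(G)\big)$. The variety $\mathcal{N}_{\mathbf{c}}$ of polynilpotent groups of class row $\mathbf{c}=(c_1,\ldots,c_l)$ consists of all groups $G$ with $\gamma_{(c_1+1,\ldots,c_l+1)}(G)=1$. An $\mathcal{N}_{\mathbf{c}}$-free group of rank $d$ is a relatively free group of this variety on $d$ free generators, i.e. a group isomorphic to $F/\gamma_{(c_1+1,\ldots,c_l+1)}(F)$ for $F$ an absolutely free group of rank $d$.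 *)

(* Defs.v *)
From HB Require Import structures.
From mathcomp Require Import all_boot.
From mathcomp Require Import monoid.
From mathcomp Require Import boolp classical_sets.

Set Implicit Arguments.
Unset Strict Implicit.
Unset Printing Implicit Defensive.

Local Open Scope classical_set_scope.
Local Open Scope group_scope.

Definition subgroup (G : groupType) (H : set G) : Prop :=
  [/\ H 1, forall x y, H x -> H y -> H (x * y) & forall x, H x -> H x^-1].

Definition normal_subgroup (G : groupType) (H : set G) : Prop :=
  subgroup H /\ forall x y, H x -> H (x ^ y).

Definition normal_closure (G : groupType) (g : G) : set G :=
  smallest (@normal_subgroup G) [set g].

Definition commutator_subgroup (G : groupType) (H K : set G) : set G :=
  smallest (@subgroup G) [set [~ x, y] | x in H & y in K].

(* [lcs i H] is gamma_i(H), indexed from 1 as usual: gamma_1(H) = H, and the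
   value at the junk index 0 is also H.  For a subgroup H the commutators are
   taken in H itself, so that this is the lower central series of the group H. *)
Definition lcs (G : groupType) (i : nat) (H : set G) : set G :=
  iter i.-1 (fun K => commutator_subgroup K H) H.

(* gamma_(c_1+1, ..., c_l+1)(G) for c = [:: c_1; ...; c_l]; c_1 is applied first. *)
Definition iterated_lcs (G : groupType) (c : seq nat) : set G :=
  foldl (fun H ci => lcs ci.+1 H) [set: G] c.
Arguments iterated_lcs : clear implicits.

Definition nilpotent_of_class_at_most (n : nat) (G : groupType) : Prop :=
  lcs n.+1 [set: G] = [set 1].

Definition conjugate (G : groupType) (g h : G) : Prop := exists k : G, g ^ k = h.

Definition magnus_property (G : groupType) : Prop :=
  forall g h : G, normal_closure g = normal_closure h ->
    conjugate g h \/ conjugate g h^-1.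

(* The absolutely free group on T: reduced words in the letters (t, false),
   standing for t, and (t, true), standing for t^-1. *)
Section FreeGroup.
Context {T : choiceType}.
Implicit Types (a b : T * bool) (u v w : seq (T * bool)).

Definition inv_letter a : T * bool := (a.1, ~~ a.2).

Definition reduced w : bool := sorted (fun a b => b != inv_letter a) w.

Definition push_letter a w : seq (T * bool) :=
  if w is b :: w' then if b == inv_letter a then w' else a :: w else [:: a].

Lemma inv_letterK : involutive inv_letter.
Proof. by case=> t s; rewrite /inv_letter /= negbK. Qed.

Lemma reduced_cons a w :
  reduced (a :: w) = (if w is b :: _ then b != inv_letter a else true) && reduced w.
Proof. by case: w. Qed.

Lemma reduced_behead a w : reduced (a :: w) -> reduced w.
Proof. by rewrite reduced_cons => /andP[]. Qed.

Lemma reduced_push a w : reduced w -> reduced (push_letter a w).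
Proof.
case: w => [//|b w] rw /=; case: ifPn => [_|ba]; first exact: reduced_behead rw.
by rewrite reduced_cons ba.
Qed.

Lemma push_id a w : reduced (a :: w) -> push_letter a w = a :: w.
Proof. by case: w => [//|b w]; rewrite reduced_cons => /andP[/negbTE/= ->]. Qed.

Lemma push_invl a w : reduced w -> push_letter (inv_letter a) (push_letter a w) = w.
Proof.
case: w => [|b w] rw /=; first by rewrite inv_letterK eqxx.
case: ifPn => [/eqP eb|ba]; last by rewrite /= inv_letterK eqxx.
by rewrite -eb push_id.
Qed.

Lemma reduced_mul u v : reduced v -> reduced (foldr push_letter v u).
Proof. by move=> rv; elim: u => //= a u IH; apply: reduced_push. Qed.

Lemma mul_push a v w : reduced v -> reduced w ->
  foldr push_letter w (push_letter a v) = push_letter a (foldr push_letter w v).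
Proof.
case: v => [//|b v] rv rw /=; case: ifPn => [/eqP ->|//] /=.
by have /= := push_invl (inv_letter a) (reduced_mul v rw); rewrite inv_letterK.
Qed.

Lemma mul_assoc u v w : reduced v -> reduced w ->
  foldr push_letter (foldr push_letter w v) u =
  foldr push_letter w (foldr push_letter v u).
Proof.
by move=> rv rw; elim: u => //= a u ->; rewrite mul_push ?reduced_mul.
Qed.

Lemma mul_nil u : reduced u -> foldr push_letter [::] u = u.
Proof.
by elim: u => //= a u IH ru; rewrite IH ?push_id ?(reduced_behead ru).
Qed.

Definition inv_word w : seq (T * bool) := rev (map inv_letter w).

Lemma inv_wordK : involutive inv_word.
Proof.
by move=> w; rewrite /inv_word map_rev revK -map_comp map_id_in // => a _;
  rewrite /= inv_letterK.
Qed.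

Lemma reduced_inv w : reduced w -> reduced (inv_word w).
Proof.
rewrite /reduced /inv_word rev_sorted sorted_map; apply: sub_sorted => a b /=.
by rewrite inv_letterK; apply: contraNN => /eqP ->.
Qed.

Lemma mul_invl w v : reduced v ->
  foldr push_letter (foldr push_letter v w) (inv_word w) = v.
Proof.
elim: w v => [//|a w IH] v rv.
rewrite /inv_word /= rev_cons -cats1 foldr_cat /= push_invl ?reduced_mul //.
exact: IH.
Qed.

End FreeGroup.

Record free_group (T : choiceType) : Type :=
  FreeGroup { word : seq (T * bool); word_reduced : reduced word }.

HB.instance Definition _ (T : choiceType) := [isSub for @word T].
HB.instance Definition _ (T : choiceType) := [Choice of free_group T by <:].

Section FreeGroupStructure.
Context {T : choiceType}.
Implicit Types x y z : free_group T.

Definition fg_mul x y : free_group T :=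
  FreeGroup (reduced_mul (word x) (word_reduced y)).
Definition fg_one : free_group T := @FreeGroup T [::] isT.
Definition fg_inv x : free_group T := FreeGroup (reduced_inv (word_reduced x)).

Lemma fg_mulA : associative fg_mul.
Proof. by move=> x y z; apply/val_inj/mul_assoc; apply: word_reduced. Qed.

Lemma fg_mul1 : left_id fg_one fg_mul.
Proof. by move=> x; apply/val_inj. Qed.

Lemma fg_mulr1 : right_id fg_one fg_mul.
Proof. by move=> x; apply/val_inj/mul_nil/word_reduced. Qed.

Lemma fg_mulV : left_inverse fg_one fg_inv fg_mul.
Proof.
move=> x; apply/val_inj.
by have := @mul_invl T (word x) [::] isT; rewrite (mul_nil (word_reduced x)).
Qed.

Lemma fg_mulrV : right_inverse fg_one fg_inv fg_mul.
Proof.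
move=> x; have <- : fg_inv (fg_inv x) = x by apply/val_inj/inv_wordK.
suff -> : fg_inv (fg_inv (fg_inv x)) = fg_inv x by exact: fg_mulV.
by apply/val_inj/inv_wordK.
Qed.

End FreeGroupStructure.

HB.instance Definition _ (T : choiceType) := isGroup.Build (free_group T)
  fg_mulA fg_mul1 fg_mulr1 fg_mulV fg_mulrV.

Definition fg_gen (T : choiceType) (t : T) : free_group T :=
  @FreeGroup T [:: (t, false)] isT.

Lemma free_group_universal (T : choiceType) (G : groupType) (x : T -> G) :
  exists! f : free_group T -> G,
    {morph f : u v / u * v} /\ (forall t, f (fg_gen t) = x t).
Proof.
pose e (a : T * bool) := if a.2 then (x a.1)^-1 else x a.1.
pose ev w := foldr (fun a g => e a * g) 1 w.
have eV a : e (inv_letter a) = (e a)^-1.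
  by case: a => t [] //=; rewrite /e /= ?invgK.
have evp a w : ev (push_letter a w) = e a * ev w.
  case: w => [//|b w] /=; case: ifPn => [/eqP ->|//].
  by rewrite /= eV mulVKg.
exists (fun u => ev (word u)); split.
  split=> [u v|t]; last by rewrite /= mulg1.
  rewrite /= /fg_mul /=; elim: (word u) => [|a w IH] /=; first by rewrite mul1g.
  by rewrite evp IH mulgA.
move=> f [fM fx]; apply/funext => u.
have f1 : f 1 = 1 by apply: (@mulgI _ (f 1)); rewrite -fM !mulg1.
have fV y : f y^-1 = (f y)^-1.
  by apply: (@mulgI _ (f y)); rewrite -fM !mulgV.
case: u => w rw /=; elim: w rw => [|a w IH] rw /=.
  by rewrite -f1; congr f; apply/val_inj.
have rw' := reduced_behead rw.
rewrite IH; have ra : reduced [:: a] by [].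
have -> : FreeGroup rw = FreeGroup ra * FreeGroup rw'.
  by apply/val_inj; rewrite /= push_id.
rewrite fM; congr (_ * _); case: a ra {rw} => t [] ra; rewrite /e /= -fx.
  by rewrite -fV; congr f; apply/val_inj.
by congr f; apply/val_inj.
Qed.

(* G is isomorphic to F / gamma_(c_1+1, ..., c_l+1)(F) for F free of rank d:
   it is the image of a homomorphism from F with that kernel. *)
Definition free_polynilpotent (c : seq nat) (d : nat) (G : groupType) : Prop :=
  exists f : {multiplicative free_group 'I_d -> G},
    range f = [set: G] /\ f @^-1` [set 1] = iterated_lcs (free_group 'I_d) c.

(* Main.v *)
From HB Require Import structures.
From mathcomp Require Import all_boot all_algebra all_field.
From mathcomp Require Import monoid.
From mathcomp Require Import boolp classical_sets.
From mathcomp Require Import zify ring lra.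
Require Import Defs.

(** The group G is F / N with F free of rank d and N the iterated commutator
    subgroup of F given by the class row c.

    If d = 1 or c is (1) or (2), then G has class at most two, so the normal
    closure of g consists of the elements g^z [g, x].  When g and h have the
    same normal closure, h = g^z [g, x] and g = h^t [h, y]; reading this on
    exponent sums gives z t = 1, hence z = 1 or z = -1, and then h or its
    inverse is a conjugate of g.  When the exponent sums of g vanish, g is
    central, and the conclusion holds because g is trivial or of infinite
    order.  These properties of G come from the normal form of a class two
    group ([normal_formE]), whose coordinates are read off in the integral
    Heisenberg group [heis]; the argument itself is [class_two_magnus].

    In all other cases d > 1, and [class_gt2] shows that the class exceeds two.
    The Magnus property fails for one of two reasons.

    If G is nilpotent of class at least three, let h = x [x, y, y] with x, y two
    free generators.  Modulo the normal closure of h the element x equals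
    [x, y, y]^-1, hence lies arbitrarily deep in the lower central series, so
    it is trivial: x and h have the same normal closure
    ([normal_closure_deep_twist]).  They are told apart by a representation in
    4 x 4 unitriangular matrices whose image has maximal class
    ([jordan_not_conj]).

    If c has length at least two, the counterexample rests on a nontrivial
    unit of the group ring of a cyclic group of order five, X + X^4 - 1, which
    has augmentation 1 and inverse X^2 + X^3 - 1.  Whenever the conjugates of a
    under the powers of t commute, t^5 a and t^5 (X + X^4 - 1)a have the
    same normal closure, X being conjugation by t
    ([normal_closure_unit_twist]).  Here t is a free generator x and a lies in
    the last nontrivial term of the lower central series of the last
    polynilpotent layer.  To see that the two elements are not conjugate, F is
    represented by upper triangular matrices over the algebraic numbers of size
    v + 1, where v is the weight at which a lives.  The matrix of x is diagonal;
    its consecutive ratios are pairwise distinct, so that a can be chosen with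
    image 1 + alpha E for the top right matrix unit E, with alpha nonzero, and on E
    conjugation by x is multiplication by a primitive fifth root of unity lam.
    Conjugacy would make lam + lam^4 - 1 a fifth root of unity, which it is not
    ([cyclotomic_unit_not_root], [twist_not_conj]). *)

Set Implicit Arguments.
Unset Strict Implicit.
Unset Printing Implicit Defensive.

Import GRing.Theory Num.Theory.
Local Open Scope classical_set_scope.
Local Open Scope group_scope.

(** * Commutator subgroups and lower central series *)

Section Subgroups.
Context {G : groupType}.
Implicit Types (H K L : set G) (g h t x y z : G).

Lemma smallest_mem (C : set G -> Prop) (X : set G) x :
  X x -> smallest C X x.
Proof. by move=> Xx A [_]; apply. Qed.

Lemma subgroup_smallest (C : set G -> Prop) (X : set G) :
  (forall A, C A -> subgroup A) -> subgroup (smallest C X).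
Proof.
move=> CS; split=> [A [/CS[A1 _ _] _] //|x y Hx Hy A AX|x Hx A AX].
  by have [_ AM _] := CS _ AX.1; apply: AM; [apply: Hx|apply: Hy].
by have [_ _ AV] := CS _ AX.1; apply: AV; apply: Hx.
Qed.

Lemma normal_closure_normal g : normal_subgroup (normal_closure g).
Proof.
split; first by apply: subgroup_smallest => A [].
by move=> x y Hx A AX; apply: AX.1.2; apply: Hx.
Qed.

Lemma normal_closure_mem g : normal_closure g g.
Proof. exact: smallest_mem. Qed.

Lemma normal_closure_sub g L : normal_subgroup L -> L g -> normal_closure g `<=` L.
Proof. by move=> nL Lg x; apply; split=> // _ ->. Qed.

Lemma commutator_subgroup_subgroup H K : subgroup (commutator_subgroup H K).
Proof. exact: subgroup_smallest. Qed.

Lemma commutator_mem H K x y : H x -> K y -> commutator_subgroup H K [~ x, y].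
Proof. by move=> Hx Ky; apply: smallest_mem; exists x => //; exists y. Qed.

Lemma commutator_sub H K L : subgroup L ->
  (forall x y, H x -> K y -> L [~ x, y]) -> commutator_subgroup H K `<=` L.
Proof. by move=> sL HKL z; apply; split=> // _ [x Hx [y Ky <-]]; apply: HKL. Qed.

Lemma commutator_normal H K : normal_subgroup H -> normal_subgroup K ->
  normal_subgroup (commutator_subgroup H K).
Proof.
move=> [_ nH] [_ nK]; have [S1 SM SV] := commutator_subgroup_subgroup H K.
split=> // x t; pose L z := commutator_subgroup H K (z ^ t).
apply: (@commutator_sub _ _ L) => [|u v Hu Kv]; last first.
  by rewrite /L conjRg; apply: commutator_mem; [apply: nH|apply: nK].
by split=> [|u v|u]; rewrite /L ?conj1g ?conjMg ?conjVg //; [apply: SM|apply: SV].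
Qed.

Lemma lcsS n H : lcs n.+2 H = commutator_subgroup (lcs n.+1 H) H.
Proof. by []. Qed.

Lemma lcs_normal n H : normal_subgroup H -> normal_subgroup (lcs n H).
Proof.
by case: n => [|n] nH //; elim: n => // n IH; rewrite lcsS; apply: commutator_normal.
Qed.

Lemma lcs_sub n H : normal_subgroup H -> lcs n H `<=` H.
Proof.
case: n => [|n] nH //; elim: n => // n IH; rewrite lcsS.
have [[_ HM HV] HJ] := nH; apply: commutator_sub => [|x y Hx Hy]; first by case: nH.
by apply: HM; [apply/HV/IH|apply/HJ/IH].
Qed.

Lemma lcs_decr n H : normal_subgroup H -> lcs n.+1 H `<=` lcs n H.
Proof.
case: n => [|n] nH //; have [[L1 LM LV] LJ] := lcs_normal n.+1 nH.
rewrite lcsS; apply: commutator_sub => [|x y Hx Hy]; first by [].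
by apply: LM; [apply: LV|apply: LJ].
Qed.

Lemma setT_normal : normal_subgroup [set: G].
Proof. by split. Qed.

Lemma iterated_lcs_rcons c n :
  iterated_lcs G (rcons c n) = lcs n.+1 (iterated_lcs G c).
Proof. by rewrite /iterated_lcs -cats1 foldl_cat. Qed.

Lemma iterated_lcs_normal c : normal_subgroup (iterated_lcs G c).
Proof.
elim/last_ind: c => [|c n IH]; first exact: setT_normal.
by rewrite iterated_lcs_rcons; apply: lcs_normal.
Qed.

(** * Normal closures and a unit of the group ring of order five *)

(** Write the abelian group generated by the conjugates of [x] additively, with
    X acting as conjugation by [t].  A normal subgroup containing t^5 y contains
    (X - 1) y, which gives one inclusion as X - 1 divides X + X^4 - 2.  If it
    contains h = t^5 u a, with u = X + X^4 - 1, it moreover contains the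
    commutator of [a] with [h], which is (X^5 - 1) a; modulo these two kinds of elements
    X fixes u a and X^5 fixes a, so that u a = (X^2 + X^3 - 1) u a = a. *)
Lemma normal_closure_unit_twist t x (a := fun i : nat => x ^ (t ^+ i)) :
  (forall i j, commute (a i) (a j)) ->
  normal_closure (t ^+ 5 * a 0%N) =
  normal_closure (t ^+ 5 * (a 1%N * a 4 * (a 0%N)^-1)).
Proof.
move=> aC.
have aCV i j : commute (a i) (a j)^-1 by apply: commuteV.
have aVV i j : commute (a i)^-1 (a j)^-1 by apply/commuteV/commute_sym.
have aJ i j : a i ^ (t ^+ j) = a (i + j)%N by rewrite /a expgnDr conjgM.
have aJ1 i : a i ^ t = a i.+1 by have := aJ i 1%N; rewrite addn1.
set b := a 1%N * a 4 * (a 0%N)^-1.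
have tJ : (t ^+ 5) ^ t = t ^+ 5 by rewrite conjXg conjgE mulKg.
have aT i : a i ^ (t ^+ 5) = a (i + 5)%N by exact: aJ.
move: (t ^+ 5) tJ aT => T tJ aT; clearbody a.
have step n y (nN : normal_subgroup n) : n (T * y) -> n (y^-1 * y ^ t).
  have [[_ nM nV] nJ] := nN; move=> ny.
  have := nM _ _ (nV _ ny) (nJ _ t ny).
  by rewrite conjMg tJ invgM -mulgA mulKg.
apply/seteqP; split; apply: normal_closure_sub => //; try exact: normal_closure_normal; last first.
  have nN := normal_closure_normal (T * a 0%N).
  move: (@normal_closure_mem (T * a 0%N)) nN.
  set N := normal_closure _ => Ng nN; have [[N1 NM NV] NJ] := nN.
  have Na i : N ((a 0%N)^-1 * a i).
    elim: i => [|i IH]; first by rewrite mulVg.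
    have := NM _ _ IH (NJ _ (t ^+ i) (step _ _ nN Ng)).
    by rewrite conjMg conjVg aJ add0n -conjgM -expgS aJ add0n mulgA mulgK.
  have -> : T * b = (T * a 0%N) * ((a 0%N)^-1 * a 1%N) * ((a 0%N)^-1 * a 4).
    by rewrite /b -!mulgA mulVKg; congr (_ * (_ * _)); apply: aCV.
  by apply: (NM) => //; apply: (NM).
have nN := normal_closure_normal (T * b).
move: (@normal_closure_mem (T * b)) nN.
set N := normal_closure _ => Nh nN; have [[N1 NM NV] NJ] := nN.
pose bb i := b ^ (t ^+ i).
have Nb i : N (b^-1 * bb i).
  elim: i => [|i IH]; first by rewrite /bb expg0 conjg1 mulVg.
  have := NM _ _ IH (NJ _ (t ^+ i) (step _ _ nN Nh)).
  by rewrite conjMg conjVg -conjgM -expgS mulgA mulgK.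
have bbE i : bb i = a (i + 1)%N * a (i + 4)%N * (a i)^-1.
  by rewrite /bb /b !conjMg conjVg !aJ addnC [(4 + i)%N]addnC.
clearbody bb.
have aCb i : commute (a i) b.
  by apply: commuteM; [apply: commuteM|].
(* The commutator of a_i with h is a_i^-1 a_(i+5), as h and T act in the same way on the a_j. *)
have N5 i : N ((a i)^-1 * a (i + 5)%N).
  have := NM _ _ (NJ _ (a i) (NV _ Nh)) Nh.
  have -> : ((T * b)^-1) ^ a i * (T * b) = (a i)^-1 * (a i) ^ (T * b).
    by rewrite !conjgE !mulgA.
  by rewrite conjgM aT (_ : a (i + 5)%N ^ b = a (i + 5)%N) //; apply/conjg_fixP/commgP/aCb.
have Nba : N (b^-1 * a 0%N).
  (* Multiplication by the inverse unit X^2 + X^3 - 1, without reducing modulo X^5 - 1. *)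
  have E : bb 2 * b^-1 * bb 3 = a 0%N * (a 6 * (a 1%N)^-1) * (a 7 * (a 2)^-1).
    have -> : bb 2 * b^-1 * bb 3 =
        a 3 * (a 6 * (a 2)^-1 * b^-1 * (a 4 * a 7)) * (a 3)^-1.
      by rewrite !bbE !mulgA.
    have -> : commute (a 3) (a 6 * (a 2)^-1 * b^-1 * (a 4 * a 7)).
      by do !apply: commuteM => //; apply: commuteV.
    rewrite mulgK.
    have -> : b^-1 = a 0%N * (a 1%N)^-1 * (a 4)^-1.
      by rewrite /b !invgM invgK mulgA -mulgA (aVV 4 1%N) mulgA.
    rewrite !mulgA mulgVK -!mulgA.
    have -> : commute (a 2)^-1 (a 0%N * ((a 1%N)^-1 * a 7)).
      by do !apply: commuteM => //; apply: commute_sym.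
    by rewrite !mulgA (aC 6 0%N).
  have -> : b^-1 * a 0%N =
      ((b^-1 * bb 2) * (b^-1 * bb 3)) * ((a 2 * (a 7)^-1) * (a 1%N * (a 6)^-1)).
    rewrite -!mulgA [bb 2 * _]mulgA [bb 2 * _ * _]mulgA E -!mulgA.
    by rewrite !(mulKg, mulVKg) mulgV mulg1.
  have V i : N (a i * (a (i + 5)%N)^-1).
    have := NJ _ (a i)^-1 (NV _ (N5 i)).
    by rewrite conjgE invgM !invgK !mulgA mulgK => Nx.
  exact: (NM _ _ (NM _ _ (Nb 2) (Nb 3)) (NM _ _ (V 2) (V 1%N))).
by have := NM _ _ Nh Nba; rewrite mulgA mulgK.
Qed.
End Subgroups.

(** * Representations of free groups *)

Section FreeGroupFacts.
Context {T : choiceType}.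

Lemma free_group_ind (P : free_group T -> Prop) : P 1 ->
  (forall t u, P u -> P (fg_gen t * u)) ->
  (forall t u, P u -> P ((fg_gen t)^-1 * u)) -> forall u, P u.
Proof.
move=> P1 PM PV [w rw]; elim: w rw => [|[t s] w IH] rw.
  by rewrite (_ : FreeGroup rw = 1) //; apply/val_inj.
have rw' := reduced_behead rw.
case: s rw => rw.
  have -> : FreeGroup rw = (fg_gen t)^-1 * FreeGroup rw'.
    by apply/val_inj; rewrite /= push_id.
  exact: PV.
have -> : FreeGroup rw = fg_gen t * FreeGroup rw'.
  by apply/val_inj; rewrite /= push_id.
exact: PM.
Qed.

Lemma free_group_subgroup (S : set (free_group T)) : subgroup S ->
  (forall t, S (fg_gen t)) -> forall u, S u.
Proof.
move=> [S1 SM SV] Sg; apply: free_group_ind => // t u Su; apply: SM => //.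
exact: SV.
Qed.
End FreeGroupFacts.

Record unit_group (R : unitRingType) :=
  UnitGroup { unit_val : R; unit_valP : unit_val \is a GRing.unit }.
HB.instance Definition _ (R : unitRingType) := [isSub for @unit_val R].
HB.instance Definition _ (R : unitRingType) := [Choice of unit_group R by <:].

Section UnitGroup.
Context {R : unitRingType}.
Local Open Scope ring_scope.
Implicit Types u v w : unit_group R.

Lemma unit_mul_proof u v : unit_val u * unit_val v \is a GRing.unit.
Proof. by rewrite unitrMl; apply: unit_valP. Qed.
Lemma unit_inv_proof u : (unit_val u)^-1 \is a GRing.unit.
Proof. by rewrite unitrV; apply: unit_valP. Qed.

Definition unit_mul u v := UnitGroup (unit_mul_proof u v).
Definition unit_one : unit_group R := UnitGroup (unitr1 R).
Definition unit_inv u := UnitGroup (unit_inv_proof u).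

Lemma unit_mulA : associative unit_mul.
Proof. by move=> u v w; apply/val_inj/mulrA. Qed.
Lemma unit_mul1 : left_id unit_one unit_mul.
Proof. by move=> u; apply/val_inj/mul1r. Qed.
Lemma unit_mulr1 : right_id unit_one unit_mul.
Proof. by move=> u; apply/val_inj/mulr1. Qed.
Lemma unit_mulV : left_inverse unit_one unit_inv unit_mul.
Proof. by move=> u; apply/val_inj/mulVr/unit_valP. Qed.
Lemma unit_mulrV : right_inverse unit_one unit_inv unit_mul.
Proof. by move=> u; apply/val_inj/mulrV/unit_valP. Qed.
End UnitGroup.

HB.instance Definition _ (R : unitRingType) := isGroup.Build (unit_group R)
  unit_mulA unit_mul1 unit_mulr1 unit_mulV unit_mulrV.

(** A homomorphism to the unit group of [R], with values taken in [R] itself so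
    that sums of images can be formed. *)
Definition ring_rep (G : groupType) (R : unitRingType) (phi : G -> R) :=
  phi 1 = 1%R /\ forall u v, phi (u * v) = (phi u * phi v)%R.

Lemma free_group_rep (T : choiceType) (R : unitRingType) (e : T -> R) :
  (forall t, e t \is a GRing.unit) ->
  exists phi : free_group T -> R, ring_rep phi /\ forall t, phi (fg_gen t) = e t.
Proof.
move=> eU.
have [f [[fM fg] _]] := free_group_universal (fun t => UnitGroup (eU t)).
exists (fun u => unit_val (f u)); split=> [|t]; last by rewrite /= fg.
split=> [|u v]; last by rewrite /= fM.
have -> : 1 = 1 * 1 :> free_group T by rewrite mulg1.
have f1 : f 1 = 1 by apply: (@mulgI _ (f 1)); rewrite -fM !mulg1.
by rewrite mulg1 /= f1.
Qed.

Lemma ring_repV (G : groupType) (R : unitRingType) (phi : G -> R) g :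
  ring_rep phi -> (phi (g^-1)%g * phi g = 1)%R.
Proof. by move=> [phi1 phiM]; rewrite -phiM mulVg. Qed.

(** * The band filtration of a triangular representation *)

Section Band.
Context {K : fieldType} {n : nat}.
Implicit Types (A B : 'M[K]_n.+1) (a b k : nat) (i j m : 'I_n.+1).
Local Open Scope ring_scope.

Definition band k A := forall i j, (j < i + k)%N -> A i j = 0.

Lemma bandD k A B : band k A -> band k B -> band k (A + B).
Proof. by move=> hA hB i j lt; rewrite mxE hA ?hB ?addr0. Qed.

Lemma bandN k A : band k A -> band k (- A).
Proof. by move=> hA i j lt; rewrite mxE hA ?oppr0. Qed.

Lemma band_le a b A : (b <= a)%N -> band a A -> band b A.
Proof. by move=> le hA i j lt; apply: hA; apply: leq_trans lt _; rewrite leq_add2l. Qed.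

Lemma band1 : band 0 (1 : 'M[K]_n.+1).
Proof.
move=> i j; rewrite addn0 => lt; rewrite mxE; case: eqP => // eij.
by rewrite eij ltnn in lt.
Qed.

Lemma bandM a b A B : band a A -> band b B -> band (a + b) (A * B).
Proof.
move=> hA hB i j lt; rewrite -mulmxE mxE big1 // => m _.
have [lt1|le1] := ltnP m (i + a); first by rewrite hA ?mul0r.
by rewrite hB ?mulr0 //; apply: leq_trans lt _; rewrite addnA leq_add2r.
Qed.

(** In the sum over the intermediate index, the first factor vanishes below its
    band and the second one above, so only one term survives on the first
    diagonal where the product can be nonzero. *)
Lemma bandM_lead a b A B i m j : band a A -> band b B ->
  m = (i + a)%N :> nat -> j = (m + b)%N :> nat -> (A * B) i j = A i m * B m j.
Proof.
move=> hA hB em ej; rewrite -mulmxE mxE (bigD1 m) //= big1 ?addr0 // => p pm.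
have [lt1|le1] := ltnP p (i + a); first by rewrite hA ?mul0r.
have : p != m :> nat by [].
rewrite (hB p j) ?mulr0 // ej em ltn_add2r ltn_neqAle le1 andbT eq_sym.
by rewrite -em.
Qed.

Lemma band_zero k A : (n < k)%N -> band k A -> A = 0.
Proof.
move=> nk hA; apply/matrixP=> i j; rewrite hA ?mxE //.
by apply: leq_trans (ltn_ord j) _; apply: leq_trans nk (leq_addl _ _).
Qed.
End Band.

Section TriangularRep.
Context {K : fieldType} {n : nat} {G : groupType} (phi : G -> 'M[K]_n.+1).
Hypotheses (rep : ring_rep phi) (tri : forall g, band 0 (phi g)).
Implicit Types (f g h x y z : G) (H S : set G) (i j m : 'I_n.+1) (a b k : nat).

(** These subgroups form a filtration in which commutators add depths; the
    entries of [phi g] on the [k]-th diagonal, for g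
    in the [k]-th subgroup and k > 0, form the leading part of [g], on which
    products become sums and commutators become Lie brackets. *)
Definition band_subgroup k : set G := [set g | band k (phi g - 1)%R].
Local Notation W := band_subgroup.

Lemma rep1 : phi 1 = 1%R. Proof. by case: rep. Qed.
Lemma repM g h : phi (g * h) = (phi g * phi h)%R. Proof. by case: rep. Qed.

Lemma rep_diagM g h i : phi (g * h) i i = (phi g i i * phi h i i)%R.
Proof. by rewrite repM (@bandM_lead _ _ 0 0 _ _ i i i) ?addn0. Qed.

Lemma rep_diagV g i : phi (g^-1)%g i i = ((phi g i i)^-1)%R.
Proof.
have E : (phi (g^-1)%g i i * phi g i i = 1)%R by rewrite -rep_diagM mulVg rep1 mxE eqxx.
by apply: (mulIf (x := phi g i i)); rewrite ?E ?mulVf //;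
  apply/eqP=> e0; move/eqP: E; rewrite e0 mulr0 eq_sym oner_eq0.
Qed.

Lemma rep_diag_neq0 g i : phi g i i != 0%R.
Proof.
apply/eqP=> e0; have := rep_diagM g^-1 g i.
by rewrite mulVg rep1 mxE eqxx e0 mulr0 => /eqP; rewrite oner_eq0.
Qed.

Lemma band_subgroup_le a b : (b <= a)%N -> W a `<=` W b.
Proof. by move=> le g; apply: band_le. Qed.

Lemma band_subgroupP k : subgroup (W k).
Proof.
split=> [|g h Wg Wh|g Wg]; rewrite /band_subgroup /=.
- by rewrite rep1 subrr => i j _; rewrite mxE.
- have -> : (phi (g * h) - 1 = (phi g - 1) * phi h + (phi h - 1))%R.
    by rewrite repM mulrBl mul1r addrA subrK.
  by apply: bandD => //; rewrite -[k]addn0; apply: bandM.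
have -> : (phi (g^-1)%g - 1 = - (phi (g^-1)%g * (phi g - 1)))%R.
  by rewrite mulrBr ring_repV // mulr1 opprB.
by apply: bandN; rewrite -[k]add0n; apply: bandM.
Qed.

Lemma rep_offdiag k g i j : (0 < k)%N -> j = (i + k)%N :> nat ->
  ((phi g - 1) i j = phi g i j)%R.
Proof.
move=> k0 e; rewrite !mxE; case: eqP => [eij|_]; last by rewrite subr0.
by move: e; rewrite eij -{1}[val j]addn0 => /addnI e0; rewrite -e0 in k0.
Qed.

Lemma band_diag k g i : (0 < k)%N -> W k g -> phi g i i = 1%R.
Proof.
move=> k0 /(_ i i); rewrite -{1}[val i]addn0 ltn_add2l => /(_ k0).
by rewrite !mxE eqxx => /eqP; rewrite subr_eq0 => /eqP.
Qed.

Lemma lead_mul k g h i j : (0 < k)%N -> W k g -> W k h -> j = (i + k)%N :> nat ->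
  phi (g * h) i j = (phi g i j + phi h i j)%R.
Proof.
move=> k0 Wg Wh e; rewrite -!(@rep_offdiag k _ i j) //.
have -> : (phi (g * h) - 1 = (phi g - 1) * phi h + (phi h - 1))%R.
  by rewrite repM mulrBl mul1r addrA subrK.
rewrite mxE; congr (_ + _)%R.
by rewrite (@bandM_lead _ _ k 0 _ _ i j j) ?addn0 // (band_diag _ k0) ?mulr1.
Qed.

Lemma lead_inv k g i j : (0 < k)%N -> W k g -> j = (i + k)%N :> nat ->
  phi (g^-1)%g i j = (- phi g i j)%R.
Proof.
move=> k0 Wg e; have [_ _ WV] := band_subgroupP k.
have := lead_mul k0 (WV _ Wg) Wg e; rewrite mulVg rep1 mxE.
case: eqP => [eij|_ /esym/eqP]; last by rewrite addr_eq0 => /eqP.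
by move: e; rewrite eij -{1}[val j]addn0 => /addnI e0; rewrite -e0 in k0.
Qed.

Lemma lead_exp k g i j p : (0 < k)%N -> W k g -> j = (i + k)%N :> nat ->
  W k (g ^+ p) /\ phi (g ^+ p) i j = (p%:R * phi g i j)%R.
Proof.
move=> k0 Wg e; have [W1 WM _] := band_subgroupP k.
elim: p => [|p [IH1 IH2]].
  split=> //; rewrite mul0r -(@rep_offdiag k _ i j) // rep1 subrr mxE //.
by split; rewrite expgS; [apply: WM|rewrite (lead_mul k0) // IH2 mulrS mulrDl mul1r].
Qed.

Lemma lead_conj k g x i j : (0 < k)%N -> W k g -> j = (i + k)%N :> nat ->
  W k (g ^ x) /\ phi (g ^ x) i j = ((phi x i i)^-1 * phi g i j * phi x j j)%R.
Proof.
move=> k0 Wg e.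
have E : (phi (g ^ x) - 1 = phi (x^-1)%g * (phi g - 1) * phi x)%R.
  by rewrite mulrBr mulr1 mulrBl ring_repV // conjgE !repM mulrA.
have B : band k (phi (x^-1)%g * (phi g - 1))%R by rewrite -[k]add0n; apply: bandM.
rewrite /band_subgroup /= -(@rep_offdiag k _ i j) // E; split.
  by rewrite -[k]addn0; apply: bandM.
rewrite (@bandM_lead _ _ k 0 _ _ i j j) ?addn0 //.
by rewrite (@bandM_lead _ _ 0 k _ _ i i j) ?addn0 // rep_diagV (@rep_offdiag k).
Qed.

(** This turns a group commutator into a Lie bracket up to the factor
    [phi (g^-1 * h^-1)], which is unipotent once g and h are, and so does not
    change the leading part. *)
Lemma rep_comm g h :
  (phi [~ g, h] - 1 = phi (g^-1 * h^-1)%g * (phi g * phi h - phi h * phi g))%R.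
Proof.
rewrite mulrBr -!repM -[X in (_ - phi X)%R]mulgA mulKg mulVg rep1.
by rewrite commgEl conjgE !mulgA.
Qed.

Lemma lie_bracket (A B : 'M[K]_n.+1) :
  (A * B - B * A = (A - 1) * (B - 1) - (B - 1) * (A - 1))%R.
Proof.
have E (X Y : 'M[K]_n.+1) : ((X - 1) * (Y - 1) = X * Y - (X + Y - 1))%R.
  by rewrite mulrBr mulr1 mulrBl mul1r -addrA -opprD addrA [(Y + X)%R]addrC.
rewrite !E [(B + A)%R]addrC; move: (A + B - 1)%R => s.
by rewrite opprB addrA subrK.
Qed.

Lemma band_comm_lie a b g h : W a g -> W b h ->
  band (a + b) (phi g * phi h - phi h * phi g)%R.
Proof.
move=> Wg Wh; rewrite lie_bracket; apply: bandD; first exact: bandM.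
by apply: bandN; rewrite addnC; apply: bandM.
Qed.

Lemma band_subgroup_comm a b g h : W a g -> W b h -> W (a + b) [~ g, h].
Proof.
move=> Wg Wh; rewrite /band_subgroup /= rep_comm -[(a + b)%N]add0n.
by apply: bandM => //; apply: band_comm_lie.
Qed.

(** The diagonal part of a triangular representation is commutative. *)
Lemma band_subgroup_comm1 g h : W 1 [~ g, h].
Proof.
rewrite /band_subgroup /= rep_comm -[1%N]add0n; apply: bandM => // i j.
rewrite addn1 ltnS leq_eqVlt => /orP[/eqP/val_inj ->|lt].
  by rewrite -!repM !mxE !rep_diagM mulrC subrr.
by rewrite -!repM !mxE !tri ?subrr ?addn0.
Qed.

Lemma lead_comm a b g h i j m (p : 'I_n.+1) : (0 < a)%N -> (0 < b)%N -> W a g -> W b h ->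
  j = (i + (a + b))%N :> nat -> m = (i + a)%N :> nat -> p = (i + b)%N :> nat ->
  phi [~ g, h] i j = (phi g i m * phi h m j - phi h i p * phi g p j)%R.
Proof.
move=> a0 b0 Wg Wh ej em ep; have [_ WM WV] := band_subgroupP 1.
have e1 : j = (m + b)%N :> nat by rewrite em ej addnA.
have e2 : j = (p + a)%N :> nat by rewrite ep ej -addnA [(b + a)%N]addnC.
have Wgh : W 1 (g^-1 * h^-1).
  by apply: (WM); apply: (WV); [apply: band_subgroup_le Wg|apply: band_subgroup_le Wh].
rewrite -(@rep_offdiag (a + b) _ i j) ?addn_gt0 ?a0 // rep_comm.
rewrite (@bandM_lead _ _ 0 (a + b) _ _ i i j) ?addn0 //; last exact: band_comm_lie.
rewrite (band_diag _ (ltn0Sn 0)) // mul1r lie_bracket.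
have subE (A B : 'M[K]_n.+1) : ((A - B) i j = A i j - B i j)%R by rewrite !mxE.
rewrite subE.
rewrite (@bandM_lead _ _ a b _ _ i m j) // (@bandM_lead _ _ b a _ _ i p j) //.
by rewrite (@rep_offdiag a g i m) ?(@rep_offdiag b h m j) ?(@rep_offdiag b h i p) ?(@rep_offdiag a g p j).
Qed.

Lemma lcs_band k n' H : H `<=` W k -> lcs n'.+1 H `<=` W (k * n'.+1)%N.
Proof.
move=> HW; elim: n' => [|p IH]; first by rewrite muln1.
rewrite lcsS mulnS addnC; apply: commutator_sub => [|g h Hg Hh].
  exact: band_subgroupP.
by apply: band_subgroup_comm; [apply: IH|apply: HW].
Qed.

Lemma lcs_band1 n' : (0 < n')%N -> lcs n'.+1 [set: G] `<=` W 1.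
Proof.
case: n' => // n' _; rewrite lcsS; apply: commutator_sub => [|g h _ _].
  exact: band_subgroupP.
exact: band_subgroup_comm1.
Qed.

(** The factor by which the depth in the band filtration grows along the
    iterated lower central series. *)
Definition height (c : seq nat) : nat := \prod_(i <- c) i.+1.

Lemma foldl_lcs_band k H (c : seq nat) : H `<=` W k ->
  foldl (fun H ci => lcs ci.+1 H) H c `<=` W (k * height c)%N.
Proof.
elim: c k H => [|p c IH] k H HW; first by rewrite /height big_nil muln1.
by rewrite /height big_cons mulnA; apply: IH; apply: lcs_band.
Qed.

(** Unlike a statement about spans of leading parts, this positionwise form
    passes to commutators: for i < m < j the matrix units E_im and E_mj have
    bracket E_ij. *)
Definition realizes S k : Prop := forall i j, j = (i + k)%N :> nat ->
  exists f, [/\ S f, W k f, phi f i j != 0%R &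
    forall i' j', j' = (i' + k)%N :> nat -> i' != i -> phi f i' j' = 0%R].

Lemma realizes_comm S H a b : (0 < a)%N -> (0 < b)%N ->
  realizes S a -> realizes H b -> realizes (commutator_subgroup S H) (a + b).
Proof.
move=> a0 b0 rS rH i j ej.
have ltm : (i + a < n.+1)%N by apply: leq_ltn_trans (ltn_ord j); lia.
have ltp : (i + b < n.+1)%N by apply: leq_ltn_trans (ltn_ord j); lia.
pose m := Ordinal ltm; pose p := Ordinal ltp.
have [f [Sf Wf f0 fz]] := rS i m erefl.
have [|h [Hh Wh h0 hz]] := rH m j; first by rewrite ej /=; lia.
exists [~ f, h]; split; first exact: commutator_mem.
- exact: band_subgroup_comm.
- rewrite (lead_comm a0 b0 Wf Wh (m := m) (p := p)) // (hz i p) //; last first.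
    by apply/eqP => /(congr1 val) /=; lia.
  by rewrite mul0r subr0 mulf_neq0.
move=> i' j' ej' ne.
have ltm' : (i' + a < n.+1)%N by apply: leq_ltn_trans (ltn_ord j'); lia.
have ltp' : (i' + b < n.+1)%N by apply: leq_ltn_trans (ltn_ord j'); lia.
pose m' := Ordinal ltm'; pose p' := Ordinal ltp'.
rewrite (lead_comm a0 b0 Wf Wh (m := m') (p := p')) // (fz i' m') // mul0r sub0r.
have [em|nm] := eqVneq i' m; last by rewrite (hz i' p') // mul0r oppr0.
rewrite (fz p' j') ?mulr0 ?oppr0 //; first by rewrite ej' /=; lia.
by apply/eqP => /(congr1 val) /=; rewrite em /=; lia.
Qed.

Lemma realizes_lcs H b n' : (0 < b)%N -> realizes H b ->
  realizes (lcs n'.+1 H) (b * n'.+1).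
Proof.
move=> b0 rH; elim: n' => [|p IH]; first by rewrite muln1.
by rewrite lcsS mulnS addnC; apply: realizes_comm => //; rewrite muln_gt0 b0.
Qed.

Lemma realizes_foldl k H (c : seq nat) : (0 < k)%N -> realizes H k ->
  realizes (foldl (fun H ci => lcs ci.+1 H) H c) (k * height c).
Proof.
elim: c k H => [|p c IH] k H k0 rH; first by rewrite /height big_nil muln1.
rewrite /height big_cons mulnA; apply: IH; last exact: realizes_lcs.
by rewrite muln_gt0 k0.
Qed.

(** Start from [y], which has no zero on the first diagonal, and kill the
    unwanted positions one at a time.  Conjugation by x^s multiplies the
    entry at (i, i+1) by N (i+1) / N i, so z -> (z^(x^s))^(N l) z^(- N (l+1))
    annihilates the entry at position [l], and [sep] says that it does not
    annihilate any other. *)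
Lemma realizes_of_separated x y (s : nat) (N : 'I_n.+1 -> nat) : W 1 y ->
  (forall i j, j = i.+1 :> nat -> phi y i j != 0%R) ->
  (forall i, (phi x i i ^+ s = (N i)%:R)%R) ->
  (forall i j i' j', j = i.+1 :> nat -> j' = i'.+1 :> nat -> i != i' ->
     ((N j * N i')%:R : K)%R != ((N j' * N i)%:R)%R) ->
  realizes [set: G] 1.
Proof.
move=> Wy y0 xN sep i j; rewrite addn1 => ej.
suff S (q : nat) : (q <= n.+1)%N -> exists f, [/\ W 1 f, phi f i j != 0%R &
    forall i' j', j' = i'.+1 :> nat -> (i' < q)%N -> i' != i -> phi f i' j' = 0%R].
  have [f [Wf f0 fz]] := S _ (leqnn _).
  by exists f; split=> // i' j'; rewrite addn1 => e ne; apply: fz.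
elim: q => [_|q IH ltq]; first by exists y; split=> //; apply: y0.
have [f [Wf f0 fz]] := IH (ltnW ltq).
pose l := Ordinal ltq.
have [eil|nil] := eqVneq i l.
  exists f; split=> // i' j' ej'; rewrite ltnS leq_eqVlt => /orP[/eqP eq|lt] ne.
    by case/eqP: ne; rewrite eil; apply: val_inj.
  exact: fz.
have [ltq1|geq1] := ltnP q.+1 n.+1; last first.
  exists f; split=> // i' j' ej'; rewrite ltnS leq_eqVlt => /orP[/eqP eq|lt] ne.
    by have := ltn_ord j'; rewrite ej' eq ltnNge geq1.
  exact: fz.
pose l' := Ordinal ltq1.
pose g := (f ^ (x ^+ s)) ^+ (N l) * (f ^+ (N l'))^-1.
have xsE i' : phi (x ^+ s) i' i' = ((N i')%:R)%R.
  rewrite -xN; elim: (s) => [|r IHr]; first by rewrite rep1 mxE eqxx.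
  by rewrite expgS rep_diagM IHr exprS.
have N0 i' : ((N i')%:R != 0 :> K)%R by rewrite -xsE rep_diag_neq0.
have [_ WM WV] := band_subgroupP 1.
have gE i' j' : j' = i'.+1 :> nat -> W 1 g /\
    phi g i' j' = (phi f i' j' * ((N l * N j')%:R - (N l' * N i')%:R) / (N i')%:R)%R.
  move=> e0; have e : j' = (i' + 1)%N :> nat by rewrite addn1.
  have [Wc cE] := @lead_conj 1 f (x ^+ s) i' j' isT Wf e.
  have [Wc1 cE1] := @lead_exp 1 _ i' j' (N l) isT Wc e.
  have [Wf1 fE1] := @lead_exp 1 _ i' j' (N l') isT Wf e.
  split; first by apply: WM => //; apply: WV.
  rewrite (@lead_mul 1) ?(@lead_inv 1) //; last exact: WV.
  rewrite cE1 fE1 cE !xsE !natrM; field.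
  exact: N0.
have [Wg gEi] := gE i j ej.
exists g; split=> //.
  rewrite gEi !mulf_neq0 ?invr_eq0 // subr_eq0.
  have := sep i j l l' ej erefl nil; rewrite [(N l * _)%N]mulnC.
  by [].
move=> i' j' ej'; rewrite ltnS leq_eqVlt => /orP[/eqP eq|lt] ne.
  have [_ ->] := gE i' j' ej'.
  have -> : i' = l by apply: val_inj.
  have -> : j' = l' by apply: val_inj; rewrite /= ej' eq.
  by rewrite mulnC subrr mulr0 mul0r.
by have [_ ->] := gE i' j' ej'; rewrite fz // !mul0r.
Qed.

(** Commutation with [x] multiplies each entry of the first diagonal by a
    nonzero scalar, so one can descend the lower central series without
    leaving the first diagonal. *)
Lemma realizes_lcs1 x n' : realizes [set: G] 1 ->
  (forall i j, j = i.+1 :> nat -> phi x i i != phi x j j) ->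
  realizes (lcs n'.+1 [set: G]) 1.
Proof.
move=> r1 xd; elim: n' => [|p IH] // i j ej.
have [f [Sf Wf f0 fz]] := IH i j ej.
have [_ _ WV] := band_subgroupP 1.
have E i' j' : j' = (i' + 1)%N :> nat -> W 1 [~ f, x] /\
    phi [~ f, x] i' j' = (phi f i' j' * (phi x j' j' / phi x i' i' - 1))%R.
  move=> e; have [Wc cE] := @lead_conj 1 f x i' j' isT Wf e.
  split; first exact: band_subgroup_comm1.
  rewrite commgEl (@lead_mul 1) ?(@lead_inv 1) //; last exact: WV.
  by rewrite cE; ring.
exists [~ f, x]; have [Wc cE] := E i j ej; split=> //.
- by rewrite lcsS; apply: commutator_mem.
- rewrite cE mulf_neq0 // subr_eq0; apply/eqP => e1.
  have /eqP[] : phi x i i != phi x j j by apply: xd; rewrite ej addn1.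
  by rewrite -[LHS]mul1r -e1 divfK // rep_diag_neq0.
by move=> i' j' ej' ne; have [_ ->] := E i' j' ej'; rewrite fz // mul0r.
Qed.

End TriangularRep.

(** * Triangular units *)

Section TriangularMatrices.
Context {K : fieldType} {n : nat}.
Implicit Types (A N : 'M[K]_n.+1).
Local Open Scope ring_scope.

Definition tri_unit A := [/\ A \is a GRing.unit, band 0 A & band 0 A^-1].

Lemma tri_unitP A B : A * B = 1 -> band 0 A -> band 0 B -> tri_unit A.
Proof.
move=> AB hA hB; have /mulmx1_unit [uA _] : A *m B = 1%:M by exact: AB.
have uA' : A \is a GRing.unit by [].
split=> //; suff -> : A^-1 = B by [].
by apply: (mulrI uA'); rewrite mulrV.
Qed.

Lemma tri_unit1 : tri_unit 1.
Proof. by apply: (@tri_unitP _ 1); rewrite ?mulr1 //; apply: band1. Qed.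

Lemma band0_diag (r : 'rV[K]_n.+1) : band 0 (diag_mx r).
Proof.
move=> i j; rewrite addn0 mxE => lt.
by case: eqP lt => [->|]; rewrite ?ltnn.
Qed.

Lemma tri_unit_diag (r : 'rV[K]_n.+1) : (forall i, r 0 i != 0) ->
  tri_unit (diag_mx r).
Proof.
move=> r0; apply: (@tri_unitP _ (diag_mx (\row_i (r 0 i)^-1))); try exact: band0_diag.
rewrite -mulmxE mulmx_diag; apply/matrixP=> i j; rewrite !mxE.
by case: eqP => // ->; rewrite mulfV.
Qed.

Lemma bandX N k : band 1 N -> band k (N ^+ k).
Proof.
move=> hN; elim: k => [|k IH]; first exact: band1.
by rewrite exprS -add1n; apply: bandM.
Qed.

(** The inverse is the finite geometric series in the nilpotent matrix - N. *)
Lemma tri_unit_unip N : band 1 N -> tri_unit (1 + N).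
Proof.
move=> hN; have hN' := bandN hN.
apply: (@tri_unitP _ (\sum_(i < n.+1) (- N) ^+ i)).
- have := subrX1 (- N) n.+1; rewrite (@band_zero _ _ n.+1 ((- N) ^+ _)) //; last first.
    exact: bandX.
  by rewrite sub0r -[_ - 1]opprD mulNr => /oppr_inj; rewrite addrC => <-.
- by apply: bandD; [apply: band1|apply: band_le hN].
elim/big_ind: _ => [i j _|A B|i _]; first by rewrite mxE.
  exact: bandD.
by apply: (@band_le _ _ i 0) => //; apply: bandX.
Qed.

End TriangularMatrices.

Lemma triangular_rep (T : choiceType) (K : fieldType) (n : nat)
    (e : T -> 'M[K]_n.+1) : (forall t, tri_unit (e t)) ->
  exists phi : free_group T -> 'M[K]_n.+1,
    [/\ ring_rep phi, forall g, band 0 (phi g) & forall t, phi (fg_gen t) = e t].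
Proof.
move=> eT; have [|phi [rep phig]] := @free_group_rep T _ e.
  by move=> t; case: (eT t).
have [phi1 phiM] := rep.
exists phi; split=> //; apply: free_group_ind => [|t u IH|t u IH].
- by rewrite phi1; apply: band1.
- by rewrite phiM phig -[0%N]addn0; apply: bandM => //; case: (eT t).
rewrite phiM -[0%N]addn0; apply: bandM => //.
have [ut _] := eT t; suff -> : phi (fg_gen t)^-1 = (e t)^-1%R by [].
by apply: (mulIr ut); rewrite mulVr // -phig ring_repV.
Qed.

(** * Class rows of length at least two *)

(** The element u = lam + lam^4 - 1 satisfies u^2 + 3 u + 1 = 0, whence
    u^5 = 55 u + 21; if this were 1, then u would be -4/11, which does not
    satisfy the quadratic equation. *)
Lemma cyclotomic_unit_not_root (lam : algC) : (lam ^+ 5 = 1)%R -> (lam != 1)%R ->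
  ((lam + lam ^+ 4 - 1) ^+ 5 != 1)%R.
Proof.
move=> l5 l1; set u := (lam + lam ^+ 4 - 1)%R.
have s0 : (1 + lam + lam ^+ 2 + lam ^+ 3 + lam ^+ 4 = 0)%R.
  apply: (mulfI (x := (lam - 1)%R)); first by rewrite subr_eq0.
  by rewrite mulr0; transitivity (lam ^+ 5 - 1)%R; [ring|rewrite l5 subrr].
have u2 : (u ^+ 2 + u *+ 3 + 1 = 0)%R.
  transitivity ((1 + lam + lam ^+ 2 + lam ^+ 3 + lam ^+ 4)
     + (lam ^+ 5 - 1) * (2 + lam ^+ 3))%R; first by rewrite /u; ring.
  by rewrite s0 l5 subrr mul0r addr0.
apply/eqP => u5.
have u1 : (u * 11 = - 4)%R.
  (* Euclidean division of u^5 by u^2 + 3 u + 1. *)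
  have e : (u ^+ 5 = 55 * u + 21)%R.
    transitivity ((u ^+ 2 + u *+ 3 + 1) * (u ^+ 3 - 3 * u ^+ 2 + 8 * u - 21)
      + 55 * u + 21)%R; first by ring.
    by rewrite u2 mul0r add0r.
  apply: (mulfI (x := 5%R)); first by rewrite pnatr_eq0.
  transitivity (55 * u + 21 - 1 - 20)%R; first by ring.
  by rewrite -e u5; ring.
have : (5 = 0 :> algC)%R.
  transitivity ((u * 11) ^+ 2 + 33 * (u * 11) + 121)%R; first by rewrite u1; ring.
  by transitivity (121 * (u ^+ 2 + u *+ 3 + 1))%R; [ring|rewrite u2 mulr0].
by move/eqP; rewrite pnatr_eq0.
Qed.

(** Consecutive differences are the odd numbers 1, 3, 5, ... and finally
    -(v-1)^2, so they are pairwise distinct, while the two ends agree. *)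
Definition twist_exponent (v i : nat) : nat := (if i == v then 1 else (i * i).+1)%N.

Lemma twist_exponent_sep v i i' : (i < v)%N -> (i' < v)%N -> i != i' ->
  (5 * (twist_exponent v i.+1 + twist_exponent v i') != 5 * (twist_exponent v i'.+1 + twist_exponent v i))%N.
Proof.
move=> lt lt' ne; rewrite eqn_pmul2l // /twist_exponent.
rewrite (ltn_eqF lt) (ltn_eqF lt').
by case: (i.+1 =P v); case: (i'.+1 =P v) => *; apply/eqP => ?; nia.
Qed.

Lemma twist_exponent_step v i : (i.+1 < v)%N -> twist_exponent v i.+1 != twist_exponent v i.
Proof.
by move=> lt; rewrite /twist_exponent (ltn_eqF lt) (ltn_eqF (ltnW lt)); apply/eqP; nia.
Qed.

Section TwistedRep.
Context (d v : nat) (lam : algC).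
Hypotheses (v0 : (0 < v)%N) (lam5 : (lam ^+ 5 = 1)%R) (lam1 : (lam != 1)%R).
Local Notation F := (free_group 'I_d.+2).
Local Notation x := (fg_gen (ord0 : 'I_d.+2)).
Local Notation y := (fg_gen (lift ord0 ord0 : 'I_d.+2)).

(** Fifth powers of these entries are integers, which makes the entries
    separable by integral operations, and the ratio of the two end entries is
    [lam]. *)
Definition twist_diag (i : 'I_v.+1) : algC :=
  (2 ^+ twist_exponent v i * (if i == v :> nat then lam else 1))%R.

Definition twist_x : 'M[algC]_v.+1 := diag_mx (\row_i twist_diag i).
Definition twist_y : 'M[algC]_v.+1 := \matrix_(i, j) ((j == i.+1 :> nat)%:R)%R.

Definition twist_gen (t : 'I_d.+2) : 'M[algC]_v.+1 :=
  (if t == ord0 then twist_x else if t == lift ord0 ord0 then 1 + twist_y else 1)%R.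

Lemma lam_neq0 : (lam != 0)%R.
Proof. by apply/eqP => l0; move: lam5; rewrite l0 expr0n /= => /esym/eqP; rewrite oner_eq0. Qed.

Lemma twist_diag5 i : (twist_diag i ^+ 5 = (2 ^ (5 * twist_exponent v i))%N%:R)%R.
Proof.
rewrite exprMn -exprM natrX [(5 * _)%N]mulnC; case: ifP => _.
  by rewrite lam5 mulr1.
by rewrite expr1n mulr1.
Qed.

Lemma twist_diag_neq0 i : (twist_diag i != 0)%R.
Proof.
apply: mulf_neq0; first by rewrite expf_neq0 // pnatr_eq0.
by case: ifP => _; rewrite ?lam_neq0 ?oner_eq0.
Qed.

Lemma twist_diag_step (i j : 'I_v.+1) : j = i.+1 :> nat -> (twist_diag i != twist_diag j)%R.
Proof.
move=> ej; apply/eqP => e.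
have : (twist_diag i ^+ 5 = twist_diag j ^+ 5)%R by rewrite e.
rewrite !twist_diag5 => /eqP; rewrite eqr_nat eqn_exp2l // eqn_pmul2l // => /eqP ee.
have [jv|jv] := eqVneq (j : nat) v; last first.
  have lt : (i.+1 < v)%N by rewrite -ej ltn_neqAle jv -ltnS ltn_ord.
  by have := twist_exponent_step lt; rewrite -ej ee eqxx.
have iv : (i == v :> nat) = false by apply/negbTE/eqP; lia.
move: e; rewrite /twist_diag ee iv jv eqxx => /mulfI e.
by move: lam1; rewrite -e ?eqxx // expf_neq0 // pnatr_eq0.
Qed.

Lemma twist_gen_tri t : tri_unit (twist_gen t).
Proof.
rewrite /twist_gen; case: ifP => _.
  by apply: tri_unit_diag => i; rewrite mxE twist_diag_neq0.
case: ifP => _; last exact: tri_unit1.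
apply: tri_unit_unip => i j lt; rewrite mxE; case: eqP => // e.
by move: lt; rewrite e addn1 ltnn.
Qed.

Lemma twisted_rep : exists phi : F -> 'M[algC]_v.+1,
  [/\ ring_rep phi, forall g, band 0 (phi g) & forall t, phi (fg_gen t) = twist_gen t].
Proof. exact/triangular_rep/twist_gen_tri. Qed.

Context (phi : F -> 'M[algC]_v.+1).
Hypotheses (rep : ring_rep phi) (tri : forall g, band 0 (phi g)).
Hypothesis phig : forall t, phi (fg_gen t) = twist_gen t.

Lemma twist_xE : phi x = twist_x. Proof. by rewrite phig /twist_gen eqxx. Qed.
Lemma twist_yE : phi y = (1 + twist_y)%R. Proof. by rewrite phig. Qed.

Lemma twist_xii i : phi x i i = twist_diag i.
Proof. by rewrite twist_xE !mxE eqxx. Qed.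

Lemma twist_realizes : realizes phi [set: F] 1.
Proof.
apply: (realizes_of_separated rep tri (x := x) (y := y) (s := 5) (N := fun i => (2 ^ (5 * twist_exponent v i))%N)).
- rewrite /band_subgroup /= twist_yE addrAC subrr add0r => i j lt.
  by rewrite mxE; case: eqP => // e; move: lt; rewrite e addn1 ltnn.
- move=> i j ej; rewrite twist_yE !mxE ej eqxx; case: (i =P j) => [e|_].
    by move: ej; rewrite e => /n_Sn.
  by rewrite add0r oner_eq0.
- by move=> i; rewrite twist_xii twist_diag5.
move=> i j i' j' ej ej' ne; rewrite eqr_nat -!expnD eqn_exp2l // -!mulnDr ej ej'.
by apply: twist_exponent_sep => //; rewrite -ltnS -?ej -?ej' ltn_ord.
Qed.

(** The ratio of the two end diagonal entries is a character of [F] with values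
    in the group generated by [lam], as can be seen on generators. *)
Lemma twist_corner_diag g : (phi g ord_max ord_max ^+ 5 = phi g ord0 ord0 ^+ 5)%R.
Proof.
move: g; apply: free_group_subgroup; first split=> [|g h eg eh|g eg] /=.
- by rewrite (rep1 rep) !mxE !eqxx.
- by rewrite !(rep_diagM rep tri) !exprMn eg eh.
- by rewrite !(rep_diagV rep tri) !exprVn eg.
move=> t; rewrite phig /twist_gen; case: ifP => _.
  have /negbTE v0' : 0%N != v by rewrite eq_sym -lt0n.
  by rewrite !mxE !eqxx /= !mulr1n !twist_diag5 /twist_exponent /= eqxx v0'.
case: ifP => _; rewrite !mxE !eqxx //=.
by rewrite (_ : (v == v.+1) = false) //; apply/negbTE; rewrite neq_ltn ltnSn.
Qed.

Lemma twist_x5 : phi (x ^+ 5) = diag_mx (\row_i (twist_diag i ^+ 5)%R).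
Proof.
elim: 5 => [|r IH].
  by rewrite (rep1 rep); apply/matrixP=> i j; rewrite !mxE.
rewrite expgS (repM rep) IH twist_xE -mulmxE mulmx_diag.
by congr diag_mx; apply/rowP => i; rewrite !mxE exprS.
Qed.

Lemma twist_x5_ends : (twist_diag ord0 ^+ 5 = 32)%R /\ (twist_diag ord_max ^+ 5 = 32)%R.
Proof.
have /negbTE v0' : 0%N != v by rewrite eq_sym -lt0n.
by split; rewrite twist_diag5 /twist_exponent /= ?eqxx ?v0'.
Qed.

Lemma twist_ratio : ((twist_diag ord0)^-1 * twist_diag ord_max = lam)%R.
Proof.
have /negbTE v0' : 0%N != v by rewrite eq_sym -lt0n.
rewrite /twist_diag /twist_exponent /= eqxx v0' mulr1 mulKf // expf_neq0 // pnatr_eq0 //.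
Qed.

Let b a : F := a ^ (x ^+ 1) * a ^ (x ^+ 4) * (a ^ (x ^+ 0))^-1.

Lemma twist_xn i p : (phi (x ^+ p)%g i i = twist_diag i ^+ p)%R.
Proof.
elim: p => [|r IH]; first by rewrite (rep1 rep) mxE eqxx.
by rewrite expgS (rep_diagM rep tri) IH twist_xii exprS.
Qed.

Lemma twist_unit_corner a : band_subgroup phi v a -> band_subgroup phi v (b a) /\
  (phi (b a) ord0 ord_max = (lam + lam ^+ 4 - 1) * phi a ord0 ord_max)%R.
Proof.
move=> Wa; have e : (ord_max : 'I_v.+1) = ((ord0 : 'I_v.+1) + v)%N :> nat by [].
have [_ WM WV] := band_subgroupP rep tri v.
have C p : band_subgroup phi v (a ^ (x ^+ p)) /\
    (phi (a ^ (x ^+ p))%g ord0 ord_max = lam ^+ p * phi a ord0 ord_max)%R.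
  have [W ->] := lead_conj rep tri (x ^+ p) v0 Wa e; split=> //.
  rewrite !twist_xn mulrAC; congr (_ * _)%R.
  by rewrite -exprVn -exprMn twist_ratio.
have [C1 E1] := C 1%N; have [C4 E4] := C 4; have [C0 E0] := C 0%N.
split; first by apply: (WM); [apply: (WM)|apply: (WV)].
rewrite (lead_mul rep tri v0 _ _ e) //; last exact: (WV); last exact: (WM).
rewrite (lead_mul rep tri v0 _ _ e) // (lead_inv rep tri v0 _ e) //.
by rewrite E1 E4 E0 expr1 expr0; ring.
Qed.

Lemma twist_mul_corner a k : band_subgroup phi v a ->
  (phi (x ^+ 5 * a * k)%g ord0 ord_max =
     32 * (phi k ord0 ord_max + phi a ord0 ord_max * phi k ord_max ord_max) /\
  phi (k * (x ^+ 5 * a))%g ord0 ord_max =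
     32 * (phi k ord0 ord_max + phi a ord0 ord_max * phi k ord0 ord0))%R.
Proof.
move=> Wa; have e : (ord_max : 'I_v.+1) = ((ord0 : 'I_v.+1) + v)%N :> nat by [].
have [p0 pv] := twist_x5_ends.
have := twist_x5; move: (x ^+ 5) => q x5.
have E (A B : 'M[algC]_v.+1) : (A * B = B + (A - 1) * B)%R.
  by rewrite mulrBl mul1r addrC subrK.
have E' (A B : 'M[algC]_v.+1) : (A * B = A + A * (B - 1))%R.
  by rewrite mulrBr mulr1 addrC subrK.
split.
  rewrite -mulgA !(repM rep) x5 -mulmxE mul_diag_mx 2!mxE p0 mulmxE E mxE.
  by rewrite (@bandM_lead _ _ v 0 _ _ _ ord_max) ?addn0 // (rep_offdiag _ _ v0 e).
have kE i j : phi (k * q) i j = (phi k i j * twist_diag j ^+ 5)%R.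
  by rewrite (repM rep) x5 -mulmxE mul_mx_diag !mxE.
rewrite mulgA [phi (k * q * a)](repM rep) E' mxE kE pv.
rewrite (@bandM_lead _ _ 0 v _ _ _ ord0) ?(rep_offdiag _ _ v0 e) //.
by rewrite kE p0; ring.
Qed.

(** Since x^5 has equal end entries, the top right entry of the conjugacy
    equation involves [k] only through its two end diagonal entries, and their
    ratio would be lam + lam^4 - 1. *)
Lemma twist_not_conj a k : band_subgroup phi v a -> (phi a ord0 ord_max != 0)%R ->
  phi (x ^+ 5 * a * k) <> phi (k * (x ^+ 5 * b a)).
Proof.
move=> Wa a0 /(congr1 (fun A : 'M_v.+1 => A ord0 ord_max)).
have [Wb bE] := twist_unit_corner Wa.
rewrite (twist_mul_corner k Wa).1 (twist_mul_corner k Wb).2 bE.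
move/(mulfI _) => /(_ _)/addrI e.
have {}e : (phi k ord_max ord_max = (lam + lam ^+ 4 - 1) * phi k ord0 ord0)%R.
  by apply: (mulfI a0); rewrite e ?pnatr_eq0 //; ring.
have := twist_corner_diag k; rewrite e exprMn -[RHS]mul1r => /mulIf e5.
by move: (cyclotomic_unit_not_root lam5 lam1); rewrite e5 ?eqxx // expf_neq0 // rep_diag_neq0.
Qed.

(** The top left entry is a conjugation invariant, equal to 32 for x^5. *)
Lemma twist_not_conjV a c k : band_subgroup phi v a -> band_subgroup phi v c ->
  phi ((x ^+ 5 * a) ^ k) <> phi (x ^+ 5 * c)^-1.
Proof.
move=> Wa Wc; have := twist_xn ord0 5; rewrite twist_x5_ends.1.
move: (x ^+ 5) => q qE /(congr1 (fun A : 'M_v.+1 => A ord0 ord0)).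
rewrite (rep_diagV rep tri) conjgE !(rep_diagM rep tri) (rep_diagV rep tri).
rewrite (band_diag _ v0 Wa) (band_diag _ v0 Wc) qE !mulr1 mulrCA mulVf ?rep_diag_neq0 //.
rewrite mulr1 => /(congr1 ( *%R 32)%R); rewrite mulfV ?pnatr_eq0 // -natrM => /eqP.
by rewrite -[1%R]/(1%:R)%R eqr_nat.
Qed.

End TwistedRep.

Lemma free_polynilpotentP (c : seq nat) (d : nat) (G : groupType) :
  free_polynilpotent c d G ->
  exists f : UMagmaMorphism.type (free_group 'I_d) G,
    (forall g, exists u, f u = g) /\
    (forall u, f u = 1 <-> iterated_lcs (free_group 'I_d) c u).
Proof.
move=> [f [fr fk]].
have f1 : f 1 = 1 by apply: (@mulgI _ (f 1)); rewrite -gmulfM !mulg1.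
pose fM := isUMagmaMorphism.Build _ _ f (f1, @gmulfM _ _ f).
pose f' : UMagmaMorphism.type (free_group 'I_d) G := HB.pack (Multiplicative.sort f) fM.
exists f'; split=> [g|u].
  have : [set: G] g by [].
  by rewrite -fr => -[u _ <-]; exists u.
by rewrite -fk; split.
Qed.

Lemma height_gt0 c : (0 < height c)%N.
Proof. by rewrite prodn_gt0. Qed.

(** With [B] the layer before the last one and [v] the weight of the last
    nontrivial term lcs (p+1) B of its lower central series, the representation
    of size v + 1 kills lcs (p+2) B but not lcs (p+1) B. *)
Lemma polynilpotent_not_magnus d c1 (mid : seq nat) p (G : groupType)
    (f : UMagmaMorphism.type (free_group 'I_d.+2) G) : (0 < c1)%N ->
  (forall g, exists u, f u = g) ->
  (forall u, f u = 1 <-> iterated_lcs (free_group 'I_d.+2) (rcons (c1 :: mid) p.+1) u) ->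
  ~ magnus_property G.
Proof.
move=> c10 fs fk MP; have [lam lamP] := C_prim_root_exists (isT : 0 < 5)%N.
have lam5 := prim_expr_order lamP.
have lam1 : (lam != 1)%R.
  apply/eqP => e; have := prim_order_dvd lamP 1.
  by rewrite expr1 e eqxx.
pose F := free_group 'I_d.+2; pose x : F := fg_gen ord0.
pose B := iterated_lcs F (c1 :: mid).
(* Entering the first layer costs depth one whatever c1 is,
   as commutation with x preserves the first diagonal. *)
pose v := (height mid * p.+1)%N.
have v0 : (0 < v)%N by rewrite muln_gt0 height_gt0.
have [phi [rep tri phig]] := twisted_rep d v lam5.
have nB : normal_subgroup B := iterated_lcs_normal _.
have hk0 := height_gt0 mid.
have rB : realizes phi B (height mid).
  rewrite -[height mid]mul1n; apply: (realizes_foldl rep tri) => //.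
  apply: (realizes_lcs1 rep tri (x := x)); first exact: (twist_realizes lam5 rep tri phig).
  by move=> i j ej; rewrite !(twist_xii phig); apply: (twist_diag_step v0 lam5 lam1).
have WB : B `<=` band_subgroup phi (height mid).
  by rewrite -[height mid]mul1n; 
  exact: (foldl_lcs_band rep tri (c := mid) (lcs_band1 rep tri c10)).
have rA : realizes phi (lcs p.+1 B) v := realizes_lcs rep tri hk0 rB.
have [//|a [Aa Wa a0 _]] := rA ord0 ord_max.
have nA : normal_subgroup (lcs p.+1 B) by apply: lcs_normal.
have kerE u : lcs p.+2 B u -> f u = 1 by move=> ku; apply/fk; rewrite iterated_lcs_rcons.
have phik u : f u = 1 -> phi u = 1%R.
  move/fk; rewrite iterated_lcs_rcons => /(lcs_band rep tri WB) Wu.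
  by apply/eqP; rewrite -subr_eq0; apply/eqP/(band_zero _ Wu); rewrite ltn_pmul2l.
have aC i j : commute (f a ^ (f x ^+ i)) (f a ^ (f x ^+ j)).
  apply/commgP/eqP; rewrite -!gmulfXn -!gmulfJ -gmulfR; apply: kerE.
  apply: commutator_mem; first exact: nA.2.
  by apply: (lcs_sub nB); apply: nA.2.
pose b : F := a ^ (x ^+ 1) * a ^ (x ^+ 4) * (a ^ (x ^+ 0))^-1.
have fb : f b = f a ^ (f x ^+ 1) * f a ^ (f x ^+ 4) * (f a ^ (f x ^+ 0))^-1.
  have fM3 (u w z : F) : f (u * w * z^-1) = f u * f w * (f z)^-1.
    by rewrite !gmulfM gmulfV.
  by rewrite fM3 !gmulfJ !gmulfXn.
have [Wb _] := twist_unit_corner v0 rep tri phig Wa.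
have := normal_closure_unit_twist aC; rewrite -fb expg0 conjg1 -(gmulfXn f 5) -!gmulfM => ncl.
have fe u w : f u = f w -> phi u = phi w.
  move=> e; have : phi (u * w^-1) = 1%R by apply: phik; rewrite gmulfM gmulfV e mulgV.
  by move/(congr1 (fun A => A * phi w)%R); rewrite -(repM rep) mulgVK mul1r.
case: (MP _ _ ncl) => -[k]; have [k' <-] := fs k; rewrite -gmulfJ.
  move=> e; apply: (twist_not_conj v0 lam5 lam1 rep tri phig (k := k') Wa a0).
  by apply: fe; rewrite conjgC gmulfM e -gmulfM.
rewrite -gmulfV => /fe; exact: (twist_not_conjV v0 lam5 rep tri phig Wa Wb).
Qed.

(** * Nilpotent groups of class at least three *)

Lemma lcs_image (G H : groupType) (f : UMagmaMorphism.type G H) n h :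
  (forall h, exists g, f g = h) -> lcs n [set: H] h ->
  exists2 g, lcs n [set: G] g & f g = h.
Proof.
move=> fs; case: n => [|n]; first by have [g <-] := fs h; exists g.
elim: n h => [|n IH] h; first by have [g <-] := fs h; exists g.
rewrite !lcsS; set S := commutator_subgroup _ [set: G].
have [S1 SM SV] := commutator_subgroup_subgroup (lcs n.+1 [set: G]) [set: G].
apply: (@commutator_sub _ _ _ (fun h => exists2 g, S g & f g = h)) => [|u w].
  split=> [|u w [g Sg <-] [k Sk <-]|u [g Sg <-]].
  - by exists 1; rewrite ?gmulf1.
  - by exists (g * k); rewrite ?gmulfM //; apply: SM.
  by exists g^-1; rewrite ?gmulfV //; apply: SV.
move=> /IH[g Sg <-] _; have [k <-] := fs w.
by exists [~ g, k]; [apply: commutator_mem|rewrite gmulfR].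
Qed.

Section NilpotentClosure.
Context {G : groupType} (M : set G).
Hypothesis nM : normal_subgroup M.

Definition mod_lcs n : set G := [set g | exists m z, [/\ M m, lcs n [set: G] z & g = m * z]].

Lemma mod_lcs_comm n g y : mod_lcs n.+1 g -> mod_lcs n.+2 [~ g, y].
Proof.
have [[M1 MM MV] MJ] := nM.
move=> [m [z [Mm Lz ->]]]; exists ((m^-1 * m ^ y) ^ z), [~ z, y]; split.
- by apply: (MJ); apply: (MM); [apply: (MV)|apply: (MJ)].
- exact: commutator_mem.
rewrite !commgEl [(m * z) ^ y]conjMg invgM; move: (m ^ y) (z ^ y) => p q.
by rewrite conjgE !mulgA mulgK.
Qed.

Lemma mod_lcs_div n g h : M h -> mod_lcs n.+1 g -> mod_lcs n.+1 (h * g^-1).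
Proof.
have [[M1 MM MV] MJ] := nM; have [[_ _ LV] _] := lcs_normal n.+1 (@setT_normal G).
move=> Mh [m [z [Mm Lz ->]]]; exists (h * (m^-1) ^ z), z^-1; split.
- by apply: (MM); [|apply: (MJ); apply: (MV)].
- exact: LV.
by rewrite invgM conjgE !mulgA mulgK.
Qed.
End NilpotentClosure.

(** If x is congruent to an element of depth k modulo the normal closure M of
    x [x, y, y], then [x, y, y], and with it x, is congruent to an element of depth k + 2. *)
Lemma normal_closure_deep_twist (G : groupType) (x y : G) n :
  lcs n.+1 [set: G] `<=` [set 1] ->
  normal_closure x = normal_closure (x * [~ x, y, y]).
Proof.
move=> Gn; apply/seteqP; split; apply: normal_closure_sub; try exact: normal_closure_normal.
  have nM := normal_closure_normal (x * [~ x, y, y]).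
  move: (@normal_closure_mem _ (x * [~ x, y, y])) nM; set M := normal_closure _ => Mh nM.
  have [[M1 MM MV] MJ] := nM.
  suff S k : mod_lcs M k.+1 x by have [m [z [Mm /Gn /= -> ->]]] := S n; rewrite mulg1.
  elim: k => [|k IH]; first by exists 1, x; rewrite mul1g.
  have := mod_lcs_div nM Mh (mod_lcs_comm nM y (mod_lcs_comm nM y IH)).
  rewrite mulgK => -[m [z [Mm Lz e]]]; exists m, z; split=> //.
  exact: (lcs_decr (@setT_normal G)).
have [[M1 MM MV] MJ] := normal_closure_normal x.
have Mx := @normal_closure_mem _ x.
have Mc g : normal_closure x g -> normal_closure x [~ g, y].
  by move=> Mg; apply: (MM); [apply: (MV)|apply: (MJ)].
by apply: (MM) => //; apply: (Mc); apply: (Mc).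
Qed.

Section MaximalClassRep.
Context (d : nat).
Local Notation F := (free_group 'I_d.+2).
Local Notation x := (fg_gen (ord0 : 'I_d.+2)).
Local Notation y := (fg_gen (lift ord0 ord0 : 'I_d.+2)).
Let o0 : 'I_4 := @Ordinal 4 0 isT.
Let o1 : 'I_4 := @Ordinal 4 1 isT.
Let o2 : 'I_4 := @Ordinal 4 2 isT.
Let o3 : 'I_4 := @Ordinal 4 3 isT.

(** The images of the two generators span a group of maximal class: y is a single
    Jordan block on the last three coordinates, and the transvection x ties the
    first coordinate to this block. *)
Definition jordan_gen (t : 'I_d.+2) : 'M[rat]_4 :=
  (if t == ord0 then 1 + delta_mx o0 o1
   else if t == lift ord0 ord0 then 1 + (delta_mx o1 o2 + delta_mx o2 o3)
   else 1 + 0)%R.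

Lemma jordan_gen_band t : band 1 (jordan_gen t - 1)%R.
Proof.
rewrite /jordan_gen; case: ifP => _; [|case: ifP => _]; rewrite addrAC subrr add0r.
- by move=> i j lt; rewrite mxE; case: eqP => //= ei; case: eqP => //= ej; move: lt; rewrite ei ej.
- move=> [[|[|[|[|//]]]] ?] [[|[|[|[|//]]]] ?] //= _;
    by rewrite !mxE -!val_eqE /= addr0.
by move=> i j lt; rewrite mxE.
Qed.

Lemma jordan_rep : exists phi : F -> 'M[rat]_4,
  [/\ ring_rep phi, forall g, band 0 (phi g) & forall t, phi (fg_gen t) = jordan_gen t].
Proof.
apply: triangular_rep => t; rewrite -[jordan_gen t](subrK 1%R) addrC.
exact/tri_unit_unip/jordan_gen_band.
Qed.

Context (phi : F -> 'M[rat]_4).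
Hypotheses (rep : ring_rep phi) (tri : forall g, band 0 (phi g)).
Hypothesis phig : forall t, phi (fg_gen t) = jordan_gen t.

Lemma jordan_W1 g : band_subgroup phi 1 g.
Proof.
move: g; apply: free_group_subgroup; first exact: (band_subgroupP rep tri 1).
by move=> t; rewrite /band_subgroup /= phig; apply: jordan_gen_band.
Qed.

Lemma jordan_diag g i : phi g i i = 1%R.
Proof. exact: (band_diag i (ltn0Sn 0) (jordan_W1 g)). Qed.

Lemma jordan_low g (i j : 'I_4) : (j < i)%N -> phi g i j = 0%R.
Proof. by move=> lt; apply: tri; rewrite addn0. Qed.

Lemma jordan_mul g h i j : phi (g * h) i j = (phi g i o0 * phi h o0 j +
  phi g i o1 * phi h o1 j + phi g i o2 * phi h o2 j + phi g i o3 * phi h o3 j)%R.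
Proof.
rewrite (repM rep) -mulmxE mxE !big_ord_recr big_ord0 /= add0r.
by do ![congr (_ + _)%R]; congr (phi g i _ * phi h _ j)%R; apply: val_inj.
Qed.

Lemma jordan_xE : [/\ phi x o0 o1 = 1, phi x o0 o2 = 0, phi x o0 o3 = 0,
  phi x o1 o2 = 0 & phi x o1 o3 = 0 /\ phi x o2 o3 = 0]%R.
Proof. by rewrite phig /jordan_gen eqxx !mxE /=. Qed.

Lemma jordan_yE : [/\ phi y o0 o1 = 0, phi y o0 o2 = 0, phi y o0 o3 = 0,
  phi y o1 o2 = 1 & phi y o1 o3 = 0 /\ phi y o2 o3 = 1]%R.
Proof. by rewrite phig /jordan_gen /= !mxE /=. Qed.

Lemma jordan_comm : band_subgroup phi 3 [~ x, y, y] /\ phi [~ x, y, y] o0 o3 = 1%R.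
Proof.
have [x01 _ _ x12 [_ x23]] := jordan_xE; have [y01 _ _ y12 [_ y23]] := jordan_yE.
have W2 : band_subgroup phi 2 [~ x, y].
  exact: (band_subgroup_comm rep tri (jordan_W1 x) (jordan_W1 y)).
split; first exact: (band_subgroup_comm rep tri W2 (jordan_W1 y)).
have E := lead_comm rep tri (ltn0Sn 1) (ltn0Sn 0) W2 (jordan_W1 y)
  (i := o0) (j := o3) (m := o2) (p := o1) erefl erefl erefl.
have E1 := lead_comm rep tri (ltn0Sn 0) (ltn0Sn 0) (jordan_W1 x) (jordan_W1 y)
  (i := o0) (j := o2) (m := o1) (p := o1) erefl erefl erefl.
by rewrite E E1 x01 y12 y01 y23 !mul0r subr0 !mulr1 subr0.
Qed.

(** The lower right 3 x 3 block of any image is a power Y^b of one Jordan block,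
    with superdiagonal entries b and corner entry b (b - 1) / 2. *)
Lemma jordan_invariant g :
  phi g o2 o3 = phi g o1 o2 /\ (2 * phi g o1 o3 = phi g o1 o2 ^+ 2 - phi g o1 o2)%R.
Proof.
move: g; pose S g := phi g o2 o3 = phi g o1 o2 /\
  (2 * phi g o1 o3 = phi g o1 o2 ^+ 2 - phi g o1 o2)%R.
suff: forall g, S g by [].
have mulE g h : [/\ phi (g * h)%g o1 o2 = phi g o1 o2 + phi h o1 o2,
    phi (g * h)%g o2 o3 = phi g o2 o3 + phi h o2 o3 &
    phi (g * h)%g o1 o3 = phi h o1 o3 + phi g o1 o2 * phi h o2 o3 + phi g o1 o3]%R.
  rewrite !jordan_mul !jordan_diag !(@jordan_low _ o1 o0) // !(@jordan_low _ o2 o0) //.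
  rewrite !(@jordan_low _ o2 o1) // !(@jordan_low _ o3 o2) // ?(@jordan_low _ o3 _) //.
  by split; ring.
have S1 : S 1 by rewrite /S (rep1 rep) !mxE.
apply: free_group_subgroup; first split=> [//|g h [g1 g2] [h1 h2]|g [g1 g2]].
- have [e1 e2 e3] := mulE g h; rewrite /S e1 e2 e3 g1 h1; split=> //.
  by rewrite !mulrDr g2 h2; ring.
- have [e1 e2 e3] := mulE g g^-1; have [e4 e5 e6] := mulE 1 1.
  rewrite !mulgV in e1 e2 e3; rewrite !(rep1 rep) !mxE /= in e1 e2 e3.
  have f1 : (phi (g^-1)%g o1 o2 = - phi g o1 o2)%R.
    by apply/eqP; rewrite -addr_eq0 addrC -e1.
  have f2 : (phi (g^-1)%g o2 o3 = - phi g o1 o2)%R.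
    by rewrite -g1; apply/eqP; rewrite -addr_eq0 addrC -e2.
  have f3 : (phi (g^-1)%g o1 o3 = phi g o1 o2 ^+ 2 - phi g o1 o3)%R.
    apply/eqP; rewrite -subr_eq0; apply/eqP; rewrite [RHS]e3 f2; ring.
  by rewrite /S f1 f2 f3 mulrBr g2; split=> //; ring.
move=> t; rewrite /S phig /jordan_gen; case: ifP => _; [|case: ifP => _]; rewrite !mxE /=; by split.
Qed.

(** The first row of the equation forces b = 0 and corner entry 1 in the lower
    right block Y^b of [phi k], against [jordan_invariant]. *)
Lemma jordan_not_conj k : phi (x * k) <> phi (k * (x * [~ x, y, y])).
Proof.
have [Wc c03] := jordan_comm; have [x01 x02 x03 x12 [x13 x23]] := jordan_xE.
move=> e.
have c0 (i j : 'I_4) : (j < i + 3)%N -> phi [~ x, y, y] i j = ((i == j)%:R)%R.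
  by move=> lt; have := Wc i j lt; rewrite !mxE => /eqP; rewrite subr_eq0 => /eqP.
move: [~ x, y, y] c03 c0 e => c c03 c0.
move: x x01 x02 x03 x12 x13 x23 => u x01 x02 x03 x12 x13 x23 e.
have E2 : phi k o1 o2 = 0%R.
  have := congr1 (fun A : 'M_4 => A o0 o2) e; rewrite mulgA.
  rewrite !jordan_mul !jordan_diag x01 x02 x03 x12 !c0 //= !(@jordan_low _ _ o0) //.
  rewrite !(@jordan_low _ o2 o1) // !(@jordan_low _ o3 o2) //; lra.
have E3 : phi k o1 o3 = 1%R.
  have := congr1 (fun A : 'M_4 => A o0 o3) e; rewrite mulgA.
  rewrite !jordan_mul !jordan_diag x01 x02 x03 x12 x13 x23 c03 !c0 //= !(@jordan_low _ _ o0) //.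
  rewrite !(@jordan_low _ o2 o1) // ?(@jordan_low _ o3 o2) // ?(@jordan_low _ o3 o1) //; lra.
have [_] := jordan_invariant k; rewrite E2 E3; move/eqP.
by rewrite expr0n /= subr0 mulr1.
Qed.
End MaximalClassRep.

Section BadNilpotent.
Context (d : nat) (G : groupType) (c : seq nat).
Context (f : UMagmaMorphism.type (free_group 'I_d.+2) G).
Hypothesis fs : forall g, exists u, f u = g.
Hypothesis fk : forall u, f u = 1 <-> iterated_lcs (free_group 'I_d.+2) c u.
Hypothesis c3 : (3 < height c)%N.
Local Notation F := (free_group 'I_d.+2).
Local Notation x := (fg_gen (ord0 : 'I_d.+2)).
Local Notation y := (fg_gen (lift ord0 ord0 : 'I_d.+2)).

Lemma jordan_factor (phi : F -> 'M[rat]_4) : ring_rep phi ->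
  (forall g, band 0 (phi g)) -> (forall t, phi (fg_gen t) = jordan_gen t) ->
  forall u w, f u = f w -> phi u = phi w.
Proof.
move=> rep tri phig u w e.
have Wu : band_subgroup phi (height c) (u * w^-1).
  have W1 : [set: F] `<=` band_subgroup phi 1 by move=> g _; apply: jordan_W1.
  rewrite -[height c]mul1n; apply: (foldl_lcs_band rep tri W1); apply/fk.
  by rewrite gmulfM gmulfV e mulgV.
have : phi (u * w^-1) = 1%R by apply/eqP; rewrite -subr_eq0; apply/eqP/(band_zero c3 Wu).
by move/(congr1 (fun A => A * phi w)%R); rewrite -(repM rep) mulgVK mul1r.
Qed.

Lemma class_gt2 : ~ nilpotent_of_class_at_most 2 G.
Proof.
move=> G2; have [phi [rep tri phig]] := jordan_rep d.
have : lcs 3 [set: G] [~ f x, f y, f y] by do 2!apply: commutator_mem => //.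
rewrite G2 /= -!gmulfR -(@gmulf1 _ _ f) => /(jordan_factor rep tri phig) e.
have [_] := jordan_comm rep tri phig; rewrite e (rep1 rep) mxE /= => /eqP.
by rewrite eq_sym oner_eq0.
Qed.

(** The inverse of h is excluded by the exponent of x, visible as the entry in
    row one and column two. *)
Lemma nilpotent_not_magnus n : lcs n.+1 [set: G] `<=` [set 1] -> ~ magnus_property G.
Proof.
move=> Gn MP; have [phi [rep tri phig]] := jordan_rep d.
have := normal_closure_deep_twist (f x) (f y) Gn; rewrite -!gmulfR -gmulfM => ncl.
have fe := jordan_factor rep tri phig.
case: (MP _ _ ncl) => -[k]; have [k' <-] := fs k; rewrite -gmulfJ.
  move=> e; apply: (jordan_not_conj rep tri phig (k := k')); apply: fe.
  by rewrite conjgC gmulfM e -gmulfM.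
rewrite -gmulfV => /fe /(congr1 (fun A : 'M_4 => A ord0 (Ordinal (isT : 1 < 4)%N))).
have W1 := jordan_W1 rep tri phig.
have [Wc _] := jordan_comm rep tri phig.
have [x01 _ _ _ _] := jordan_xE phig.
have o01 : Ordinal (isT : 1 < 4)%N = ((ord0 : 'I_4) + 1)%N :> nat by [].
rewrite (lead_conj rep tri k' (ltn0Sn 0) (W1 x) o01).2 (lead_inv rep tri (ltn0Sn 0) (W1 _) o01).
rewrite (lead_mul rep tri (ltn0Sn 0) (W1 _) (W1 _) o01) !(jordan_diag rep tri phig).
have -> : phi [~ x, y, y] ord0 (Ordinal (isT : 1 < 4)%N) = 0%R.
  by have := Wc ord0 (Ordinal (isT : 1 < 4)%N) isT; rewrite !mxE /= subr0.
have -> : phi x ord0 (Ordinal (isT : 1 < 4)%N) = 1%R.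
  by rewrite -x01; congr (phi x _ _); apply: val_inj.
by move/eqP; rewrite invr1 !mulr1 addr0.
Qed.

End BadNilpotent.

(** * Groups of class two *)

Section IntegerPowers.
Context {G : groupType}.
Implicit Types (g h : G) (z : int).

Definition zpow g z : G :=
  match z with Posz n => g ^+ n | Negz n => g ^- n.+1 end.

Lemma zpowS g z : zpow g (z + 1)%R = zpow g z * g.
Proof.
case: z => [n|[|n]].
- by rewrite (_ : (Posz n + 1)%R = Posz n.+1) /= ?expgSr //; lia.
- by rewrite (_ : (Negz 0 + 1)%R = Posz 0) //= expg1 mulVg.
have -> : (Negz n.+1 + 1)%R = Negz n by lia.
by rewrite /= [g ^+ n.+2]expgS invgM mulgVK.
Qed.

Lemma zpowB1 g z : zpow g (z - 1)%R = zpow g z * g^-1.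
Proof. by rewrite -[in RHS](subrK 1%R z) zpowS mulgK. Qed.

Lemma zpowD g z t : zpow g (z + t)%R = zpow g z * zpow g t.
Proof.
elim/int_ind: t => [|n IH|n IH]; first by rewrite addr0 mulg1.
  by rewrite -addn1 PoszD addrA !zpowS IH mulgA.
by rewrite -addn1 PoszD opprD addrA !zpowB1 IH mulgA.
Qed.

Lemma zpowN g z : zpow g (- z)%R = (zpow g z)^-1.
Proof. by apply: (mulgI (zpow g z)); rewrite -zpowD subrr mulgV. Qed.

Lemma zpowM g z t : zpow g (z * t)%R = zpow (zpow g z) t.
Proof.
elim/int_ind: t => [|n IH|n IH]; first by rewrite mulr0.
  by rewrite -addn1 PoszD [RHS]zpowS mulrDr mulr1 zpowD IH.
by rewrite -addn1 PoszD opprD [RHS]zpowB1 mulrDr mulrN1 zpowD IH (zpowN g).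
Qed.

Lemma zpow1g z : zpow 1 z = 1 :> G.
Proof. by case: z => n /=; rewrite expg1n ?invg1. Qed.

Lemma commute_zpow g h z : commute g h -> commute g (zpow h z).
Proof. by case: z => n gh /=; [|apply: commuteV]; apply: commuteX. Qed.
End IntegerPowers.

Lemma gmulf_zpow (G H : groupType) (f : UMagmaMorphism.type G H) g z :
  f (zpow g z) = zpow (f g) z.
Proof. by case: z => n /=; rewrite ?gmulfV gmulfXn. Qed.

Definition class_two (G : groupType) : Prop :=
  forall g h k : G, commute [~ g, h] k.

Section ClassTwo.
Context {G : groupType}.
Hypothesis G2 : class_two G.
Implicit Types (g h k x y : G).

Lemma class_two_nilpotent : nilpotent_of_class_at_most 2 G.
Proof.
apply/seteqP; split=> z; last by move=> ->; case: (lcs_normal 3 (@setT_normal G)) => -[].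
have cen : lcs 2 [set: G] `<=` [set z | forall k, commute z k].
  apply: commutator_sub => [|x y _ _ k]; last exact: G2.
  split=> [k|g h cg ch k|g cg k] /=; apply/commute_sym; first exact: commute1.
    by apply: commuteM; apply/commute_sym.
  by apply/commuteV/commute_sym.
have s1 : subgroup [set 1 : G].
  by split=> [|x y -> ->|x ->] //=; rewrite ?mulg1 ?invg1.
move: z; apply: commutator_sub => // x y Lx _.
by apply/eqP/commgP/cen.
Qed.

Lemma commMl g h k : [~ g * h, k] = [~ g, k] * [~ h, k].
Proof.
rewrite [LHS]commgEl conjMg invgM -mulgA [g^-1 * _]mulgA -commgEl.
by rewrite [h^-1 * _]mulgA -(G2 g k h^-1) -mulgA.
Qed.

Lemma commMr g h k : [~ g, h * k] = [~ g, h] * [~ g, k].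
Proof. by rewrite -[LHS]invgR commMl invgM !invgR (G2 g k [~ g, h]). Qed.

Lemma commVl g k : [~ g^-1, k] = [~ g, k]^-1.
Proof. by apply: (mulgI [~ g, k]); rewrite -commMl mulgV mulgV comm1g. Qed.

Lemma commVr g k : [~ g, k^-1] = [~ g, k]^-1.
Proof. by rewrite -[LHS]invgR commVl invgR. Qed.

Lemma comm_zpow g k z : [~ g, zpow k z] = zpow [~ g, k] z.
Proof.
elim/int_ind: z => [|n IH|n IH]; first by rewrite commg1.
  by rewrite -addn1 PoszD !zpowS commMr IH.
by rewrite -addn1 PoszD opprD !zpowB1 commMr commVr IH.
Qed.

Lemma zpow_comm g k z : [~ zpow g z, k] = zpow [~ g, k] z.
Proof.
elim/int_ind: z => [|n IH|n IH]; first by rewrite comm1g.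
  by rewrite -addn1 PoszD !zpowS commMl IH.
by rewrite -addn1 PoszD opprD !zpowB1 commMl commVl IH.
Qed.

(** In class two, commutators with [g] are central and bilinear, so the elements
    on the right already form a normal subgroup. *)
Lemma normal_closure_class_two g h : normal_closure g h ->
  exists z x, h = zpow g z * [~ g, x].
Proof.
apply: (@normal_closure_sub _ _ [set h | exists z x, h = zpow g z * [~ g, x]]).
  split; first split.
  - by exists 0%R, 1; rewrite commg1 mulg1.
  - move=> _ _ [z [x ->]] [t [y ->]]; exists (z + t)%R, (x * y).
    rewrite zpowD commMr; move: [~ g, x] [~ g, y] (G2 g x (zpow g t)) => p q pC.
    by rewrite -!mulgA [p * (_ * _)]mulgA pC -mulgA.
  - move=> _ [z [x ->]]; exists (- z)%R, x^-1.
    by rewrite zpowN commVr invgM (commuteV (commute_sym (commuteV (G2 g x _)))).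
  move=> _ k [z [x ->]]; exists z, (x * zpow k z).
  have cJ : [~ g, x] ^ k = [~ g, x] by rewrite conjgE (G2 g x k) mulKg.
  have e : zpow g z ^ k = zpow g z * [~ zpow g z, k] by rewrite commgEl mulVKg.
  rewrite conjMg e cJ commMr comm_zpow -zpow_comm (G2 g x [~ zpow g z, k]).
  by move: [~ _, _] [~ _, _] => p q; rewrite mulgA.
by exists 1%R, 1; rewrite commg1 mulg1.
Qed.
End ClassTwo.

(** With h = g^z [g, x] and g = h^t [h, y], applying [theta] gives z t = 1 when
    theta g is nonzero.  Otherwise g is central, both commutators vanish, and
    g^(z t - 1) = 1 leads to the same conclusion unless g = 1. *)
Lemma class_two_magnus (F G : groupType) (f : UMagmaMorphism.type F G) (d : nat)
    (theta : F -> 'rV[int]_d) : class_two G ->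
  (forall g, exists u, f u = g) ->
  (forall u w, theta (u * w) = (theta u + theta w)%R) ->
  (forall u, f u = 1 -> theta u = 0%R) ->
  (forall u, theta u = 0%R -> forall k, commute (f u) k) ->
  (forall u z, theta u = 0%R -> zpow (f u) z = 1 -> z = 0%R \/ f u = 1) ->
  magnus_property G.
Proof.
move=> G2 fs tM tk tc tt.
have t1 : theta 1 = 0%R by apply: tk; rewrite gmulf1.
have tV u : theta u^-1 = (- theta u)%R.
  by apply/eqP; rewrite -addr_eq0 -tM mulVg t1.
have tz u z : theta (zpow u z) = (z *: theta u)%R.
  have S n : Posz n.+1 = (Posz n + 1)%R by lia.
  elim/int_ind: z => [|n IH|n IH]; first by rewrite scale0r.
    by rewrite S zpowS tM IH scalerDl scale1r.
  by rewrite S opprD zpowB1 tM IH tV scalerDl scaleN1r.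
have tR u w : theta [~ u, w] = 0%R.
  by rewrite commgEl conjgE !tM !tV [(theta u + theta w)%R]addrC addKr addNr.
have tf u w : f u = f w -> theta u = theta w.
  move=> e; apply/eqP; rewrite -subr_eq0 -tV -tM; apply/eqP/tk.
  by rewrite gmulfM gmulfV e mulgV.
have key u w : normal_closure (f u) (f w) -> exists z x,
    f w = zpow (f u) z * [~ f u, x] /\ theta w = (z *: theta u)%R.
  move=> /(normal_closure_class_two G2)[z [x e]]; exists z, x; split=> //.
  have [v fv] := fs x; rewrite -tz -[RHS]addr0 -(tR u v) -tM; apply: tf.
  by rewrite e gmulfM gmulf_zpow gmulfR fv.
move=> g h; have [u <-] := fs g; have [w <-] := fs h => ncl.
have [|z [x [ew tw]]] := key u w; first by rewrite ncl; apply: normal_closure_mem.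
have [|t [y [eu tu]]] := key w u; first by rewrite -ncl; apply: normal_closure_mem.
have [zt|g1] : (z * t = 1)%R \/ f u = 1; last 1 first.
- by left; exists 1; rewrite ew g1 zpow1g comm1g conjg1 mulg1.
- have [u0|u0] := eqVneq (theta u) 0%R; last first.
    left; have /rV0Pn[i ui] := u0.
    have := congr1 (fun v : 'rV_d => v ord0 i) tu; rewrite tw scalerA mxE.
    by rewrite -[LHS]mul1r => /(mulIf ui); rewrite mulrC.
  have c1 k : [~ f u, k] = 1 by apply/eqP/commgP/tc.
  have {}ew : f w = zpow (f u) z by rewrite ew c1 mulg1.
  have w0 : theta w = 0%R by rewrite tw u0 scaler0.
  have {}eu : f u = zpow (f u) (z * t).
    rewrite {1}eu zpowM -ew (_ : [~ f w, y] = 1) ?mulg1 //.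
    exact/eqP/commgP/tc.
  have [] := tt u (z * t - 1)%R u0; last by right.
    by rewrite zpowB1 -eu mulgV.
  by move/eqP; rewrite subr_eq0 => /eqP; left.
have [z1|z1] : z = 1%R \/ z = (-1)%R.
  have : (z \is a GRing.unit) by apply/unitrPr; exists t.
  by rewrite unfold_in /= => /orP[/eqP|/eqP]; [left|right].
  by left; exists x; rewrite ew z1 /= expg1 commgEl mulVKg.
right; exists x^-1; rewrite ew z1 invgM zpowN invgK -(commVr G2) commgEl.
by rewrite (_ : zpow (f u) 1 = f u) //; move: (G2 (f u) x^-1 (f u)); rewrite commgEl => ->; rewrite mulVKg.
Qed.

(** * Normal form in a class two group *)

(** The free associative ring on d letters, truncated after degree two, contains
    1 + (elements of positive degree) as a group; a pair (a, m) stands for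
    1 + a + m, with a of degree one and m of degree two. *)
Definition heis (d : nat) : Type := ('rV[int]_d * 'M[int]_d)%type.
HB.instance Definition _ d := Choice.on (heis d).

Section Heisenberg.
Context {d : nat}.
Local Open Scope ring_scope.
Implicit Types e : heis d.

Definition heis_mul e1 e2 : heis d :=
  (e1.1 + e2.1, e1.2 + e2.2 + e1.1^T *m e2.1).
Definition heis_one : heis d := (0, 0).
Definition heis_inv e : heis d := (- e.1, - e.2 + e.1^T *m e.1).

Lemma heis_mulA : associative heis_mul.
Proof.
move=> e1 e2 e3; rewrite /heis_mul /= addrA mulmxDr.
rewrite (_ : (e1.1 + e2.1)^T = e1.1^T + e2.1^T) ?mulmxDl; last by apply/matrixP=> i j; rewrite !mxE.
congr (_, _); rewrite -!addrA; do 2!congr (_ + _).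
by rewrite [RHS]addrCA; congr (_ + _); rewrite [LHS]addrC -addrA.
Qed.
Lemma heis_mul1 : left_id heis_one heis_mul.
Proof. by case=> a m; rewrite /heis_mul /= !add0r trmx0 mul0mx addr0. Qed.
Lemma heis_mulr1 : right_id heis_one heis_mul.
Proof. by case=> a m; rewrite /heis_mul /= !addr0 mulmx0 addr0. Qed.
Lemma heis_mulV : left_inverse heis_one heis_inv heis_mul.
Proof.
case=> a m; rewrite /heis_mul /heis_inv /= addNr (_ : (- a)^T = - a^T) ?mulNmx; last first.
  by apply/matrixP=> i j; rewrite !mxE.
by rewrite addrAC -[- m + _ - _]addrA subrr addr0 addNr.
Qed.
Lemma heis_mulrV : right_inverse heis_one heis_inv heis_mul.
Proof.
by case=> a m; rewrite /heis_mul /heis_inv /= subrr mulmxN addrA subrr add0r subrr.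
Qed.
End Heisenberg.

HB.instance Definition _ d := isGroup.Build (heis d)
  heis_mulA heis_mul1 heis_mulr1 heis_mulV heis_mulrV.

Lemma heis_rep d : exists psi : UMagmaMorphism.type (free_group 'I_d) (heis d),
  forall t, psi (fg_gen t) = (delta_mx ord0 t, 0)%R.
Proof.
have [f [[fM fg] _]] := free_group_universal (fun t : 'I_d => (delta_mx ord0 t, 0%R) : heis d).
have f1 : f 1 = 1 by apply: (@mulgI _ (f 1)); rewrite -fM !mulg1.
pose fM' := isUMagmaMorphism.Build _ _ f (f1, fM).
pose psi : UMagmaMorphism.type (free_group 'I_d) (heis d) := HB.pack f fM'.
by exists psi.
Qed.

Section NormalForm.
Context (d : nat) {G : groupType} (X : 'I_d.+1 -> G).
Hypothesis G2 : class_two G.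
Implicit Types (a : 'rV[int]_d.+1) (m : 'M[int]_d.+1) (k : 'I_d.+1).

Definition nf_power a : G :=
  \prod_(0 <= i < d.+1) zpow (X (inord i)) (a ord0 (inord i)).
Definition nf_comm m : G :=
  \prod_(0 <= i < d.+1) \prod_(0 <= j < i)
    zpow [~ X (inord i), X (inord j)] (m (inord i) (inord j)).
(** An element is collected as the product of the x_i^(a_i) in increasing order
    times powers of the central commutators of x_i and x_j with j < i.  The
    exponent of such a commutator is m_ij because m_ij is the signed number of times
    that x_i occurs in front of x_j. *)
Definition normal_form (e : heis d.+1) : G := nf_power e.1 * nf_comm e.2.

Lemma comm_prod g (I : Type) (s : seq I) (F : I -> G) :
  [~ g, \prod_(i <- s) F i] = \prod_(i <- s) [~ g, F i].
Proof.
elim: s => [|i s IH]; first by rewrite !big_nil commg1.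
by rewrite !big_cons (commMr G2) IH.
Qed.

Lemma central_prodM (I : Type) (s : seq I) (F H : I -> G) :
  (forall i g, commute (F i) g) -> (forall i g, commute (H i) g) ->
  \prod_(i <- s) (F i * H i) = (\prod_(i <- s) F i) * (\prod_(i <- s) H i).
Proof.
move=> cF cH; elim: s => [|i s IH]; first by rewrite !big_nil mulg1.
rewrite !big_cons IH -!mulgA; congr (_ * _).
by rewrite [LHS]mulgA (cH i (\prod_(j <- s) F j)) mulgA.
Qed.

Lemma central_zpow (g h g' : G) z : commute (zpow [~ g, h] z) g'.
Proof. by apply/commute_sym/commute_zpow/commute_sym/G2. Qed.

Lemma central_prod (I : Type) (s : seq I) (F : I -> G) g :
  (forall i g, commute (F i) g) -> commute (\prod_(i <- s) F i) g.
Proof. by move=> cF; apply/commute_sym/commute_prod => i _; apply/commute_sym. Qed.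

Lemma nf_commD m m' : nf_comm (m + m')%R = nf_comm m * nf_comm m'.
Proof.
rewrite /nf_comm -central_prodM; last 2 first.
- by move=> i g; apply: central_prod => j h; apply: central_zpow.
- by move=> i g; apply: central_prod => j h; apply: central_zpow.
apply: eq_bigr => i _; rewrite -central_prodM; try by move=> j h; apply: central_zpow.
by apply: eq_bigr => j _; rewrite mxE zpowD.
Qed.

Lemma nf_comm_central m g : commute (nf_comm m) g.
Proof.
by apply: central_prod => i h; apply: central_prod => j h'; apply: central_zpow.
Qed.

Lemma prod_split (F : nat -> G) k : \prod_(0 <= i < d.+1) F i =
  (\prod_(0 <= i < k) F i) * F k * \prod_(k.+1 <= i < d.+1) F i.
Proof.
rewrite (@big_cat_nat _ _ _ k) //= ?(ltnW (ltn_ord k)) // [X in _ * X]big_ltn //.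
by rewrite mulgA.
Qed.

Lemma inord_neq (i : nat) k : (i < d.+1)%N -> i != k -> (inord i == k) = false.
Proof. by move=> lt ne; apply/negbTE; apply: contra ne => /eqP <-; rewrite inordK. Qed.

(** Moving x_k to the right past the powers of x_j with j < k produces the
    commutators [x_k, x_j]^(a_j), exactly what the term e_k^T a contributes. *)
Lemma normal_form_gen k e :
  normal_form (((delta_mx ord0 k, 0)%R : heis d.+1) * e) = X k * normal_form e.
Proof.
case: e => a m; rewrite /normal_form /=.
set T := \prod_(0 <= j < k) zpow [~ X k, X (inord j)] (a ord0 (inord j)).
have -> : nf_comm (0 + m + (delta_mx ord0 k)^T *m a)%R = T * nf_comm m.
  rewrite add0r nf_commD nf_comm_central; congr (_ * _).
  rewrite /nf_comm (prod_split _ k) big_nat big1 ?mul1g; last first.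
    move=> i /andP[_ lt]; apply: big1 => j _; rewrite mxE big_ord1 !mxE eqxx /=.
    by rewrite inord_neq ?mul0r ?(ltn_trans lt) // ltn_eqF.
  rewrite [X in _ * X]big_nat [X in _ * X]big1 ?mulg1; last first.
    move=> i /andP[lt lt']; apply: big1 => j _; rewrite mxE big_ord1 !mxE eqxx /=.
    by rewrite inord_neq ?mul0r // gtn_eqF.
  by apply: eq_bigr => j _; rewrite mxE big_ord1 !mxE inord_val !eqxx mul1r.
rewrite !mulgA; congr (_ * _).
rewrite /nf_power !(prod_split _ k) inord_val !mxE !eqxx /=.
have E (r : seq nat) : (forall i, i \in r -> (i < d.+1)%N /\ i != k) ->
    \prod_(i <- r) zpow (X (inord i)) ((delta_mx ord0 k + a)%R ord0 (inord i)) =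
    \prod_(i <- r) zpow (X (inord i)) (a ord0 (inord i)).
  move=> hr; apply: eq_big_seq => i /hr[lt ne].
  by rewrite !mxE eqxx /= inord_neq // add0r.
rewrite !E; last 2 first.
- by move=> i; rewrite mem_index_iota => /andP[lt lt']; rewrite gtn_eqF.
- move=> i; rewrite mem_index_iota => /andP[_ lt].
  by rewrite (ltn_trans lt) // ltn_eqF.
set A := \prod_(0 <= i < k) _; set B := \prod_(k.+1 <= i < d.+1) _.
have eT : T = [~ X k, A].
  by rewrite comm_prod; apply: eq_bigr => j _; rewrite comm_zpow.
have cT g : commute T g by rewrite eT; apply: G2.
rewrite zpowD (_ : zpow (X k) 1 = X k) // -cT !mulgA eT.
by rewrite -[_ * A * X k]mulgA (G2 _ _ (A * X k)) -commgC.
Qed.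

(** Left translation by a generator agrees on both sides by [normal_form_gen];
    the elements for which this holds form a subgroup. *)
Lemma normal_formE (f : UMagmaMorphism.type (free_group 'I_d.+1) G)
    (psi : UMagmaMorphism.type (free_group 'I_d.+1) (heis d.+1)) :
  (forall t, f (fg_gen t) = X t) ->
  (forall t, psi (fg_gen t) = (delta_mx ord0 t, 0)%R) ->
  forall u, f u = normal_form (psi u).
Proof.
move=> fX psiE u.
suff S : forall u e, normal_form (psi u * e) = f u * normal_form e.
  rewrite -[psi u]mulg1 S [normal_form 1](_ : _ = 1) ?mulg1 //.
  rewrite /normal_form /nf_power /nf_comm /= big1 ?mul1g => [|i _]; last by rewrite mxE.
  by apply: big1 => i _; apply: big1 => j _; rewrite mxE.
apply: free_group_subgroup; first split=> [e|v w Sv Sw e|v Sv e].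
- by rewrite !gmulf1 !mul1g.
- by rewrite !gmulfM -!mulgA Sv Sw.
- by rewrite !gmulfV; apply: (mulgI (f v)); rewrite -Sv mulVKg mulVKg.
by move=> t e; rewrite psiE fX normal_form_gen.
Qed.
End NormalForm.

(** * Free abelian and free class two groups *)

Section FreeClassTwo.
Context (d : nat) {G : groupType}.
Local Notation F := (free_group 'I_d.+1).
Context (f : UMagmaMorphism.type F G) (psi : UMagmaMorphism.type F (heis d.+1)).
Hypothesis fs : forall g, exists u, f u = g.
Hypothesis psiE : forall t, psi (fg_gen t) = (delta_mx ord0 t, 0)%R.
Implicit Types (u w : F) (e : heis d.+1).

Lemma heis_central e e' : e.1 = 0%R -> commute e e'.
Proof.
case: e e' => a m [b n] /= ->; rewrite /commute; congr (_, _) => /=.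
  by rewrite addrC.
by rewrite trmx0 mul0mx mulmx0 !addr0 addrC.
Qed.

Lemma heis_comm1 e e' : [~ e, e'].1 = 0%R.
Proof. by case: e e' => a m [b n] /=; rewrite [(a + b)%R]addrC addKr addNr. Qed.

(** The kernel of the projection to exponent sums is the additive group of
    matrices, hence torsion-free. *)
Lemma heis_zpow e z : e.1 = 0%R -> zpow e z = (0, z *: e.2)%R.
Proof.
move=> e1; have S n : Posz n.+1 = (Posz n + 1)%R by lia.
case: e e1 => a m /= ->; elim/int_ind: z => [|n IH|n IH]; first by rewrite scale0r.
  by rewrite S zpowS IH; congr (_, _); rewrite /= ?addr0 // mulmx0 addr0 scalerDl scale1r.
rewrite S opprD zpowB1 IH; congr (_, _); rewrite /= ?oppr0 ?addr0 //.
by rewrite trmx0 !mul0mx !addr0 scalerDl scaleN1r.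
Qed.

Lemma lcs2_exponents u : lcs 2 [set: F] u -> (psi u).1 = 0%R.
Proof.
apply: (@commutator_sub _ _ _ (fun u => (psi u).1 = 0%R)) => [|v w _ _].
  split=> [|v w v0 w0|v v0]; rewrite ?gmulf1 ?gmulfM ?gmulfV //=.
    by rewrite v0 w0 addr0.
  by rewrite v0 oppr0.
by rewrite gmulfR heis_comm1.
Qed.

Lemma lcs3_heis u : lcs 3 [set: F] u -> psi u = 1.
Proof.
apply: (@commutator_sub _ _ _ (fun u => psi u = 1)) => [|v w /lcs2_exponents v0 _].
  by split=> [|v w v1 w1|v v1]; rewrite ?gmulf1 ?gmulfM ?gmulfV ?v1 ?w1 ?mulg1 ?invg1.
by rewrite gmulfR; apply/eqP/commgP/heis_central.
Qed.

(** Vanishing exponent sums leave only the commutator part of the normal form. *)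
Lemma exponents0_comm : class_two G -> forall u, (psi u).1 = 0%R ->
  f u = nf_comm (fun t => f (fg_gen t)) (psi u).2.
Proof.
move=> G2 u u0; rewrite (@normal_formE _ _ (fun t => f (fg_gen t)) G2 f psi _ psiE) // /normal_form u0.
by rewrite /nf_power big1 ?mul1g // => i _; rewrite mxE.
Qed.

Let exponentsM u w : (psi (u * w)).1 = ((psi u).1 + (psi w).1)%R.
Proof. by rewrite gmulfM. Qed.

Lemma class_two_of_kernel : (forall u, lcs 3 [set: F] u -> f u = 1) -> class_two G.
Proof.
move=> fk g h k; have [u <-] := fs g; have [v <-] := fs h; have [w <-] := fs k.
apply/commgP/eqP; rewrite -!gmulfR; apply: fk.
by do 2!apply: commutator_mem => //.
Qed.

Lemma free_class_two_magnus :
  (forall u, f u = 1 <-> lcs 3 [set: F] u) -> magnus_property G.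
Proof.
move=> fk; have G2 : class_two G by apply: class_two_of_kernel => u /fk.
apply: (class_two_magnus G2 fs exponentsM) => [u /fk/lcs3_heis -> //|u u0 k|u z u0].
  by rewrite exponents0_comm //; apply: nf_comm_central.
rewrite -gmulf_zpow => /fk/lcs3_heis; rewrite gmulf_zpow heis_zpow // => e.
have [->|z0] := eqVneq z 0%R; [by left|right].
have m0 : (psi u).2 = 0%R.
  apply/matrixP=> i j; have /(congr1 (fun m : 'M_d.+1 => m i j)) := congr1 snd e.
  by rewrite /= !mxE => /eqP; rewrite mulf_eq0 (negbTE z0) => /eqP.
have -> : f u = nf_comm (fun t => f (fg_gen t)) (psi u).2 by apply: exponents0_comm.
by rewrite m0; apply: big1 => i _; apply: big1 => j _; rewrite mxE.
Qed.

Lemma free_abelian_magnus : (forall g h : G, commute g h) ->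
  (forall u, f u = 1 -> lcs 2 [set: F] u) -> magnus_property G.
Proof.
move=> Gab fk; have G2 : class_two G by move=> g h k; apply: Gab.
apply: (class_two_magnus G2 fs exponentsM) => [u /fk/lcs2_exponents //|u u0 k //|u z u0 _].
right; rewrite exponents0_comm //; apply: big1 => i _; apply: big1 => j _.
by rewrite (eqP (introT commgP (Gab _ _))) zpow1g.
Qed.

End FreeClassTwo.

Lemma free_group1_abelian d (u w : free_group 'I_d) : d = 1%N -> commute u w.
Proof.
move=> d1; subst d.
pose x : free_group 'I_1 := fg_gen ord0.
have sub (v : free_group 'I_1) : subgroup [set w | commute v w].
  split=> [|g h cg ch|g cg] /=; [exact: commute1|exact: commuteM|exact: commuteV].
have cx : forall w, commute x w.
  by apply: (free_group_subgroup (sub x)) => t; rewrite (ord1 t).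
by move: w; apply: (free_group_subgroup (sub u)) => t; rewrite (ord1 t); apply/commute_sym/cx.
Qed.

(** * The classification *)

Lemma iterated_lcs_sub2 (G : groupType) c1 (c : seq nat) : (0 < c1)%N ->
  iterated_lcs G (c1 :: c) `<=` lcs 2 [set: G].
Proof.
case: c1 => // n _; elim/last_ind: c => [|c p IH].
  elim: n => // n IH u Lu; apply: IH; exact: (lcs_decr (@setT_normal G)).
rewrite -rcons_cons iterated_lcs_rcons => u Lu; apply: IH.
by move: Lu; apply: lcs_sub; apply: iterated_lcs_normal.
Qed.

Lemma height_gt3 (c : seq nat) : all (leq 1) c -> c != [::] -> c != [:: 1%N] ->
  c != [:: 2] -> (3 < height c)%N.
Proof.
case: c => [|c1 [|c2 c]] //; first by rewrite /height big_seq1; case: c1 => [|[|[|p]]].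
move=> /and3P[c10 c20 _] _ _ _; have := height_gt0 c; rewrite /height !big_cons; nia.
Qed.

Local Close Scope group_scope.
Local Close Scope classical_set_scope.

Theorem theorem1p1 (d l : nat) (c : l.-tuple nat) (G : groupType) :
  0 < d -> 0 < l -> (forall i : 'I_l, 0 < tnth c i) ->
  free_polynilpotent c d G ->
  (magnus_property G <-> nilpotent_of_class_at_most 2 G) /\
  (magnus_property G <->
     d = 1 \/ (c = [:: 1] :> seq nat) \/ (c = [:: 2] :> seq nat)).
Proof.
move=> d0 l0 c0 /free_polynilpotentP[f [fs fk]].
have cpos : all (leq 1) c.
  by apply/allP => _ /tnthP[i ->]; apply: c0.
have cn : (c : seq nat) != [::] by rewrite -size_eq0 size_tuple -lt0n.
move: (c : seq nat) fk cpos cn => {c0 l0 l} {}c fk cpos cn.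
suff [good bad] : (d = 1 \/ c = [:: 1] \/ c = [:: 2] ->
     magnus_property G /\ nilpotent_of_class_at_most 2 G) /\
   (~ (d = 1 \/ c = [:: 1] \/ c = [:: 2]) ->
     ~ magnus_property G /\ ~ nilpotent_of_class_at_most 2 G).
  have [y|n] := pselect (d = 1 \/ c = [:: 1] \/ c = [:: 2]).
    by have [m k] := good y; split; split.
  by have [m k] := bad n; split; split.
case: d d0 f fs fk => // d _ f fs fk; split.
- have [psi psiE] := heis_rep d.+1.
  have ab : (forall g h : G, commute g h) -> magnus_property G /\ nilpotent_of_class_at_most 2 G.
    move=> Gab; split; last by apply: class_two_nilpotent => g h k; apply: Gab.
    apply: (free_abelian_magnus fs psiE Gab) => u /fk.
    case: (c) cpos cn => // c1 c' /andP[c10 _] _; exact: iterated_lcs_sub2.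
  case=> [d1|[ec|ec]].
  + apply: ab => g h; have [u <-] := fs g; have [w <-] := fs h; apply: gmulf_commute.
    exact: free_group1_abelian.
  + apply: ab => g h; have [u <-] := fs g; have [w <-] := fs h.
    by apply/commgP/eqP; rewrite -gmulfR; apply/fk; rewrite ec; apply: commutator_mem.
  split; first by apply: (free_class_two_magnus fs psiE) => u; rewrite fk ec.
  by apply/class_two_nilpotent/(class_two_of_kernel fs) => u Lu; apply/fk; rewrite ec.
move=> n; case: d f fs fk n => [|d] f fs fk n; first by case: n; left.
have c3 : 3 < height c.
  by apply: height_gt3 => //; apply/eqP => ec; apply: n; right; [left|right].
split; last exact: (class_gt2 fk c3).
case/lastP: c cpos cn fk c3 n => // c p; rewrite all_rcons => /andP[p0 cpos] _ fk c3 n.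
case: p p0 fk c3 {n} => // p _ fk c3.
case: c cpos fk c3 => [|c1 mid] cpos fk c3; last first.
  by case/andP: cpos => c10 _; apply: (polynilpotent_not_magnus c10 fs fk).
apply: (nilpotent_not_magnus fs fk c3 (n := p.+1)) => h Lh.
have [u Lu <-] := lcs_image fs Lh.
exact/fk.
Qed.
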